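(* Let $G=G_1\times\cdots\times G_n$ be any product of groups $G_i$, and let $X$ be a proper CAT(0) space with a $G$-action by isometries. Then either there is a $G$-fixed point in $\partial X$, or there is a non-empty closed convex $G$-invariant subspace $Z\subseteq X$ which splits $G$-equivariantly isometrically as a product of $G_i$-spaces $Z_i$.
   Context: A metric space is proper if its closed balls are compact. $\partial X$ is the boundary at infinity of $X$ (equivalence classes of asymptotic geodesic rays). The product $Z_1\times\cdots\times Z_n$ is endowed with the $\ell^2$-product metric and with the product action of $G_1\times\cdots\times G_n$, each $Z_i$ being a metric space with an isometric $G_i$-action. *)

(* Defs.v *)
From HB Require Import structures.
From mathcomp Require Import all_boot all_order all_algebra.
From mathcomp Require Import boolp classical_sets functions reals topology.
From mathcomp Require Import ring.
Set Implicit Arguments.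
Unset Strict Implicit.
Unset Printing Implicit Defensive.
Import Order.TTheory GRing.Theory Num.Theory.
Local Open Scope classical_set_scope.
Local Open Scope ring_scope.

(* The product group G_1 x ... x G_n, indexed by 'I_n. *)
Definition prodG (n : nat) (G : 'I_n -> groupType) : Type := forall i, G i.

Section ProductGroup.
Variables (n : nat) (G : 'I_n -> groupType).

HB.instance Definition _ := Choice.copy (prodG G) (forall i, G i).

Let one : prodG G := fun i => 1%g.
Let mul (g h : prodG G) : prodG G := fun i => (g i * h i)%g.
Let inv (g : prodG G) : prodG G := fun i => (g i)^-1%g.

Let mulA : associative mul.
Proof. by move=> g h k; apply: functional_extensionality_dep => i; exact: mulgA. Qed.
Let mul1 : left_id one mul.
Proof. by move=> g; apply: functional_extensionality_dep => i; exact: mul1g. Qed.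
Let mulr1 : right_id one mul.
Proof. by move=> g; apply: functional_extensionality_dep => i; exact: mulg1. Qed.
Let mulV : left_inverse one inv mul.
Proof. by move=> g; apply: functional_extensionality_dep => i; exact: mulVg. Qed.
Let mulrV : right_inverse one inv mul.
Proof. by move=> g; apply: functional_extensionality_dep => i; exact: mulgV. Qed.

HB.instance Definition _ :=
  isGroup.Build (prodG G) mulA mul1 mulr1 mulV mulrV.
End ProductGroup.

Section L2Norm.
Variables (R : realType) (n : nat).
Implicit Types a b : 'I_n -> R.

Definition l2norm a : R := Num.sqrt (\sum_i a i ^+ 2).

Lemma l2norm_ge0 a : 0 <= l2norm a.
Proof. exact: sqrtr_ge0. Qed.

Lemma l2norm_sqr a : l2norm a ^+ 2 = \sum_i a i ^+ 2.
Proof. by rewrite sqr_sqrtr// sumr_ge0// => i _; exact: sqr_ge0. Qed.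

Lemma l2norm_eq0 a : l2norm a = 0 -> forall i, a i = 0.
Proof.
move=> a0 i; have := l2norm_sqr a; rewrite a0 expr0n /= => /esym/eqP.
rewrite psumr_eq0 => [/allP/(_ i)|j _]; last exact: sqr_ge0.
by rewrite mem_index_enum sqrf_eq0 => /(_ isT)/eqP.
Qed.

Lemma l2norm_CS a b : \sum_i a i * b i <= l2norm a * l2norm b.
Proof.
have [/eqP a0|aN0] := eqVneq (l2norm a) 0.
  have z := l2norm_eq0 (eqP a0); rewrite big1 => [|i _]; last by rewrite z mul0r.
  by rewrite mulr_ge0// l2norm_ge0.
have [/eqP b0|bN0] := eqVneq (l2norm b) 0.
  have z := l2norm_eq0 (eqP b0); rewrite big1 => [|i _]; last by rewrite z mulr0.
  by rewrite mulr_ge0// l2norm_ge0.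
have agt0 : 0 < l2norm a by rewrite lt_neqAle eq_sym aN0 l2norm_ge0.
have bgt0 : 0 < l2norm b by rewrite lt_neqAle eq_sym bN0 l2norm_ge0.
have : 0 <= \sum_i (l2norm b * a i - l2norm a * b i) ^+ 2.
  by apply: sumr_ge0 => i _; exact: sqr_ge0.
have -> : \sum_i (l2norm b * a i - l2norm a * b i) ^+ 2 =
    2 * (l2norm a * l2norm b) * (l2norm a * l2norm b - \sum_i a i * b i).
  transitivity (l2norm b ^+ 2 * (\sum_i a i ^+ 2)
      - 2 * (l2norm a * l2norm b) * (\sum_i a i * b i)
      + l2norm a ^+ 2 * (\sum_i b i ^+ 2)).
    by rewrite !mulr_sumr -sumrB -big_split /=; apply: eq_bigr => i _; ring.
  by rewrite -!l2norm_sqr; ring.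
by rewrite pmulr_rge0 ?subr_ge0// !mulr_gt0.
Qed.

Lemma l2norm_triangle a b : l2norm (fun i => a i + b i) <= l2norm a + l2norm b.
Proof.
rewrite -(@ler_pXn2r _ 2) ?nnegrE ?addr_ge0 ?l2norm_ge0//.
rewrite l2norm_sqr sqrrD !l2norm_sqr.
under eq_bigr => i _ do rewrite sqrrD.
by rewrite !big_split /= lerD2r lerD2l mulr2n lerD ?l2norm_CS.
Qed.

Lemma ler_l2norm a b :
  (forall i, 0 <= a i) -> (forall i, a i <= b i) -> l2norm a <= l2norm b.
Proof.
move=> a0 ab; apply: ler_wsqrtr; apply: ler_sum => i _.
by rewrite ler_pXn2r// nnegrE// (le_trans (a0 i)).
Qed.
End L2Norm.

(* The l^2-product of metric spaces.  It is a named alias so that its metric is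
   not confused with the product uniformity on dependent functions. *)
Definition l2prod (R : realType) (n : nat) (Z : 'I_n -> metricType R) : Type :=
  forall i, Z i.

Section L2Product.
Variables (R : realType) (n : nat) (Z : 'I_n -> metricType R).

HB.instance Definition _ := Choice.copy (l2prod Z) (forall i, Z i).

Definition l2dist (x y : l2prod Z) : R := l2norm (fun i => mdist (x i) (y i)).

Let l2distxx x : l2dist x x = 0.
Proof.
by rewrite /l2dist /l2norm big1 ?sqrtr0// => i _; rewrite mdistxx expr0n.
Qed.

Let l2dist_positivity x y : l2dist x y = 0 -> x = y.
Proof.
move=> /l2norm_eq0 xy; apply: functional_extensionality_dep => i.
exact: mdist_positivity (xy i).
Qed.

Let l2dist_sym x y : l2dist x y = l2dist y x.
Proof.
rewrite /l2dist /l2norm; congr Num.sqrt.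
by apply: eq_bigr => i _; rewrite metric_sym.
Qed.

Let l2dist_triangle y x z : l2dist x z <= l2dist x y + l2dist y z.
Proof.
apply: le_trans (l2norm_triangle _ _); apply: ler_l2norm => i.
  exact: mdist_ge0.
exact: metric_triangle.
Qed.

HB.instance Definition _ := isMetric.Build R (l2prod Z)
  l2distxx l2dist_positivity l2dist_sym l2dist_triangle.
End L2Product.

Section MetricGeometry.
Variables (R : realType) (X : metricType R).

Definition proper_space : Prop :=
  forall (x : X) (r : R), compact [set y | mdist x y <= r].

(* Only the restriction of c to [0, d(x, y)] matters. *)
Definition geodesic (c : R -> X) (x y : X) : Prop :=
  [/\ c 0 = x, c (mdist x y) = y &
      forall s t, 0 <= s <= mdist x y -> 0 <= t <= mdist x y ->
        mdist (c s) (c t) = `|s - t|].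

Definition geodesic_space : Prop := forall x y : X, exists c, geodesic c x y.

Definition edist (p q : 'rV[R]_2) : R := l2norm (fun i => p 0 i - q 0 i).

Definition esegment (p q : 'rV[R]_2) : set 'rV[R]_2 :=
  [set (1 - t) *: p + t *: q | t in [set t : R | 0 <= t <= 1]].

(* The triangle has vertices v 0, v 1, v 2 and sides c i from v i to its cyclic
   successor; w is a comparison triangle in the Euclidean plane, and p', q' are
   the comparison points of c i s and c j t (note d(v i, c i s) = s). *)
Definition CAT0 : Prop :=
  geodesic_space /\
  forall (v : 'I_3 -> X) (c : 'I_3 -> R -> X) (w : 'I_3 -> 'rV[R]_2),
    (forall i, geodesic (c i) (v i) (v (ordS i))) ->
    (forall i, edist (w i) (w (ordS i)) = mdist (v i) (v (ordS i))) ->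
    forall (i j : 'I_3) (s t : R) (p' q' : 'rV[R]_2),
      0 <= s <= mdist (v i) (v (ordS i)) ->
      0 <= t <= mdist (v j) (v (ordS j)) ->
      esegment (w i) (w (ordS i)) p' -> edist (w i) p' = s ->
      esegment (w j) (w (ordS j)) q' -> edist (w j) q' = t ->
      mdist (c i s) (c j t) <= edist p' q'.

Definition geodesically_convex (C : set X) : Prop :=
  forall x y, C x -> C y ->
    (exists c, geodesic c x y) /\
    forall c, geodesic c x y -> forall t, 0 <= t <= mdist x y -> C (c t).

(* Only the restriction of c to [0, +oo[ matters; values at negative times are
   irrelevant to asymptoty, hence to the boundary. *)
Definition ray (c : R -> X) : Prop :=
  forall s t, 0 <= s -> 0 <= t -> mdist (c s) (c t) = `|s - t|.

Definition asymptotic (c c' : R -> X) : Prop :=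
  exists K : R, forall t, 0 <= t -> mdist (c t) (c' t) <= K.

Definition ray_class (c : R -> X) : set (R -> X) :=
  [set c' | ray c' /\ asymptotic c c'].

Definition boundary : set (set (R -> X)) :=
  [set ray_class c | c in [set c | ray c]].

Definition isometric_action (G : groupType) (a : G -> X -> X) : Prop :=
  [/\ forall x, a 1%g x = x,
      forall g h x, a (g * h)%g x = a g (a h x) &
      forall g x y, mdist (a g x) (a g y) = mdist x y].

(* For f a bijective isometry, this maps the class of c onto that of f \o c. *)
Definition boundary_map (f : X -> X) (xi : set (R -> X)) : set (R -> X) :=
  [set f \o c | c in xi].

Definition fixed_boundary_point (G : groupType) (a : G -> X -> X) : Prop :=
  exists2 xi, boundary xi & forall g, boundary_map (a g) xi = xi.

Definition action_invariant (G : groupType) (a : G -> X -> X) (C : set X) :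
    Prop :=
  forall g x, C x -> C (a g x).

End MetricGeometry.

Arguments proper_space {R} X.
Arguments CAT0 {R} X.

Definition prod_action (R : realType) (n : nat) (G : 'I_n -> groupType)
    (Z : 'I_n -> metricType R) (b : forall i, G i -> Z i -> Z i) :
    prodG G -> l2prod Z -> l2prod Z :=
  fun g z i => b i (g i) (z i).

Lemma prod_action_isometric (R : realType) (n : nat) (G : 'I_n -> groupType)
    (Z : 'I_n -> metricType R) (b : forall i, G i -> Z i -> Z i) :
  (forall i, isometric_action (b i)) -> isometric_action (prod_action b).
Proof.
move=> bP; split=> [z|g h z|g z z'].
- by apply: functional_extensionality_dep => i; case: (bP i) => + _ _; apply.
- by apply: functional_extensionality_dep => i; case: (bP i) => _ + _; apply.
- congr Num.sqrt; apply: eq_bigr => i _; congr (_ ^+ 2).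
  by case: (bP i) => _ _; apply.
Qed.

(* f is a G-equivariant isometry of the product of the G_i-spaces Z_i onto C. *)
Definition splits_equivariantly (R : realType) (X : metricType R) (n : nat)
    (G : 'I_n -> groupType) (a : prodG G -> X -> X) (C : set X) : Prop :=
  exists (Z : 'I_n -> metricType R) (b : forall i, G i -> Z i -> Z i),
    (forall i, isometric_action (b i)) /\
    exists f : l2prod Z -> X,
      [/\ forall z z', mdist (f z) (f z') = mdist z z',
          range f = C &
          forall g z, f (prod_action b g z) = a g (f z)].

(* Main.v *)
Require Import Defs.
From HB Require Import structures.
From mathcomp Require Import all_boot all_order all_algebra.
From mathcomp Require Import boolp classical_sets functions reals topology.
From mathcomp Require Import ring lra.
Set Implicit Arguments.
Unset Strict Implicit.
Unset Printing Implicit Defensive.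
Import Order.TTheory GRing.Theory Num.Theory.
Local Open Scope classical_set_scope.
Local Open Scope ring_scope.

(* Without fixed point at infinity the action is non-evanescent: a set on which
   every group element has bounded displacement is bounded. If two subgroups H
   and H' commute and generate the group, displacements of elements of H' are
   constant along H-orbits, so minimal closed convex H-invariant sets exist:
   projecting a point onto a decreasing chain yields points of bounded
   displacement. Any two minimal H-sets are parallel (nearest-point projection
   is an isometry between them), their union is closed, convex and invariant,
   and an isometry of a minimal set commuting with H is the identity, since its
   displacement is constant and its iterates would otherwise drift to infinity
   with bounded displacement. Hence projections between minimal H-sets are
   compatible and H' acts trivially on the minimal H-factor.
   Now take Z minimal for G, and in it M_i minimal for each G_i. The
   projections Z -> M_i are the coordinates of the splitting. *)

(** * Points and distances in the Euclidean comparison plane *)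

Section Comparison.
Variable R : realType.
Implicit Types p q : 'rV[R]_2.

Lemma edist_sqr p q :
  edist p q ^+ 2 = (p 0 0 - q 0 0) ^+ 2 + (p 0 1 - q 0 1) ^+ 2.
Proof.
rewrite /edist l2norm_sqr !big_ord_recl big_ord0 addr0.
by do 2?[congr (_ + _)]; congr ((_ - _) ^+ 2); congr (_ 0 _); apply/val_inj.
Qed.

Lemma edist_eq p q (r : R) : 0 <= r -> edist p q ^+ 2 = r ^+ 2 -> edist p q = r.
Proof.
move=> r0 /eqP; rewrite eqrXn2 ?l2norm_ge0// => /eqP; exact.
Qed.

Definition plane_point (u v : R) : 'rV[R]_2 :=
  \row_j (if j == 0 then u else v).

Lemma plane_point_dist u v u' v' :
  edist (plane_point u v) (plane_point u' v') ^+ 2 =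
  (u - u') ^+ 2 + (v - v') ^+ 2.
Proof. by rewrite edist_sqr !mxE. Qed.

End Comparison.

(** * The CAT(0) inequality *)

Section CAT0.
Variables (R : realType) (X : metricType R).
Hypothesis X_CAT0 : CAT0 X.
Implicit Types (x y z p q : X) (t : R).
Local Notation d := (@mdist R X).

(** Encoding the point at ratio [t] by two distances lets isometries preserve it without any choice
    of geodesic. *)
Definition between t x y p : Prop :=
  d x p = t * d x y /\ d p y = (1 - t) * d x y.

Definition geo x y : R -> X := projT1 (cid (proj1 X_CAT0 x y)).

Lemma geo_geodesic x y : geodesic (geo x y) x y.
Proof. by rewrite /geo; case: cid. Qed.

Lemma geodesic_between (c : R -> X) x y t : geodesic c x y -> 0 <= t <= 1 ->
  between t x y (c (t * d x y)).
Proof.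
move=> [c0 cd cP] /andP[t0 t1]; have D := mdist_ge0 x y.
have tD : 0 <= t * d x y <= d x y by apply/andP; split; nra.
have [tD0 tD1] := andP tD.
split.
  have := cP 0 (t * d x y); rewrite c0 => ->//; last by rewrite lexx.
  by rewrite sub0r normrN ger0_norm.
have := cP (t * d x y) (d x y); rewrite cd => ->//; last by rewrite lexx D.
rewrite distrC ger0_norm ?subr_ge0//.
by ring.
Qed.

(* The comparison triangle has its base on the first coordinate axis. *)
Lemma geodesic_stewart (c : R -> X) x y z t : geodesic c x y -> 0 <= t <= 1 ->
  d z (c (t * d x y)) ^+ 2 <=
  (1 - t) * d z x ^+ 2 + t * d z y ^+ 2 - t * (1 - t) * d x y ^+ 2.
Proof.
move=> cP t01; have [bx by_] := geodesic_between cP t01.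
have [L0|LN0] := eqVneq (d x y) 0.
  have xy := mdist_positivity _ _ L0; subst y.
  have -> : c (t * d x x) = x.
    by apply/esym/mdist_positivity; rewrite bx L0 mulr0.
  by rewrite L0; lra.
have L0 : 0 < d x y by rewrite lt_neqAle eq_sym LN0 mdist_ge0.
set L := d x y in LN0 L0 *.
(* Law of cosines: [u] is the abscissa of the comparison vertex of [z], with [x] at the origin and
   [y] at distance [L] on the axis. The triangle inequalities bound [u] by [d z x] in absolute
   value, so the height [h] exists. *)
set u := (d z x ^+ 2 + L ^+ 2 - d y z ^+ 2) / (2 * L).
have uE : 2 * L * u = d z x ^+ 2 + L ^+ 2 - d y z ^+ 2.
  by rewrite /u mulrC divfK// mulf_neq0 ?pnatr_eq0.
have ge1 := mdist_ge0 z x; have ge2 := mdist_ge0 y z.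
have t1 : L <= d z x + d y z.
  by rewrite /L (metric_sym z) (metric_sym y z); exact: metric_triangle.
have t2 : d y z <= L + d z x.
  by rewrite /L (metric_sym x y) (metric_sym z x); exact: metric_triangle.
have t3 : d z x <= L + d y z.
  rewrite /L (metric_sym x y) (metric_sym y z) addrC; exact: metric_triangle.
have hu : 0 <= d z x ^+ 2 - u ^+ 2.
  have h1 : u <= d z x.
    have : 0 <= (d y z - (d z x - L)) * (d y z + (d z x - L)).
      by apply: mulr_ge0; lra.
    by rewrite -(@ler_pM2l _ (2 * L)) ?uE; nra.
  have h2 : - d z x <= u.
    have : 0 <= (d z x + L - d y z) * (d z x + L + d y z).
      by apply: mulr_ge0; lra.
    by rewrite -(@ler_pM2l _ (2 * L)) ?uE; nra.
  by nra.
rewrite (metric_sym z y).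
pose h := Num.sqrt (d z x ^+ 2 - u ^+ 2).
have hE : h ^+ 2 = d z x ^+ 2 - u ^+ 2 by rewrite /h sqr_sqrtr.
pose v (i : 'I_3) := nth x [:: x; y; z] i.
pose w (i : 'I_3) :=
  nth (plane_point 0 0)
    [:: plane_point 0 0; plane_point L 0; plane_point u h] i.
pose cc (i : 'I_3) := if i == 0 then c else geo (v i) (v (ordS i)).
have ccP i : geodesic (cc i) (v i) (v (ordS i)).
  rewrite /cc; case: eqP => [->|_]; [exact: cP|exact: geo_geodesic].
have w12 : edist (plane_point L 0) (plane_point u h) = d y z.
  by apply: edist_eq => //; rewrite plane_point_dist; lra.
have wP i : edist (w i) (w (ordS i)) = d (v i) (v (ordS i)).
  case: i => [[|[|[|//]]] i] /=; apply: edist_eq; rewrite ?mdist_ge0//.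
  - by rewrite /w/v/= plane_point_dist -/L; ring.
  - by rewrite /w/v/= w12.
  - by rewrite /w/v/= plane_point_dist; lra.
have tL : 0 <= t * L <= L.
  by case/andP: t01 => *; apply/andP; split; nra.
pose i1 : 'I_3 := Ordinal (isT : 1 < 3)%N.
(* The vertex [z] enters as the far end, at parameter [d y z], of the side starting at [y]. *)
have := X_CAT0.2 v cc w ccP wP 0 i1 (t * L) (d y z) (plane_point (t * L) 0)
  (plane_point u h) tL.
have -> : cc i1 (d y z) = z by case: (ccP i1).
have -> : cc 0 (t * L) = c (t * L) by [].
have key : d (c (t * L)) z <= edist (plane_point (t * L) 0) (plane_point u h) ->
  d z (c (t * L)) ^+ 2 <=
  (1 - t) * d z x ^+ 2 + t * d y z ^+ 2 - t * (1 - t) * L ^+ 2.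
  move=> le; rewrite metric_sym.
  apply: (@le_trans _ _ (edist (plane_point (t * L) 0) (plane_point u h) ^+ 2)).
    by rewrite ler_pXn2r// nnegrE ?mdist_ge0 ?l2norm_ge0.
  rewrite plane_point_dist le_eqVlt; apply/orP; left; apply/eqP.
  have -> : (t * L - u) ^+ 2 + (0 - h) ^+ 2 =
    t ^+ 2 * L ^+ 2 - t * (2 * L * u) + u ^+ 2 + h ^+ 2 by ring.
  by rewrite hE uE; ring.
move=> H; apply: key; apply: H.
- by rewrite lexx ge2.
- exists t => //=; apply/rowP => j; rewrite !mxE.
  by case: ifP => _; rewrite !mulr0 ?addr0 ?add0r.
- apply: edist_eq; first by case/andP: tL.
  by rewrite plane_point_dist; ring.
- by exists 1 => /=; [rewrite ler01 lexx|rewrite subrr scale0r add0r scale1r].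
- exact: w12.
Qed.

Lemma between_sym t x y p : between t x y p -> between (1 - t) y x p.
Proof.
by case=> xp py; split; rewrite metric_sym (metric_sym y x) ?xp ?py//; ring.
Qed.

(** Stewart's inequality seen from [p] itself has right-hand side zero. *)
Lemma between_geo t x y p : 0 <= t <= 1 -> between t x y p ->
  p = geo x y (t * d x y).
Proof.
move=> t01 [xp py]; apply: mdist_positivity.
have := geodesic_stewart p (geo_geodesic x y) t01.
rewrite (metric_sym p x) xp py => h.
have : d p (geo x y (t * d x y)) ^+ 2 <= 0 by apply: le_trans h _; lra.
by move=> h'; apply/eqP; rewrite -sqrf_eq0 eq_le h' sqr_ge0.
Qed.

Lemma between_uniq t x y p q : 0 <= t <= 1 ->
  between t x y p -> between t x y q -> p = q.
Proof. by move=> t01 /(between_geo t01) -> /(between_geo t01) ->. Qed.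

Definition seg x y t : X := geo x y (t * d x y).

Lemma segP t x y : 0 <= t <= 1 -> between t x y (seg x y t).
Proof. by move=> t01; apply: geodesic_between => //; exact: geo_geodesic. Qed.

Lemma stewart t x y z p : 0 <= t <= 1 -> between t x y p ->
  d z p ^+ 2 <= (1 - t) * d z x ^+ 2 + t * d z y ^+ 2 - t * (1 - t) * d x y ^+ 2.
Proof.
by move=> t01 /(between_geo t01) ->; apply: geodesic_stewart => //; exact: geo_geodesic.
Qed.

Lemma ler_dist2 x y x' y' : d x y ^+ 2 <= d x' y' ^+ 2 -> d x y <= d x' y'.
Proof. by rewrite ler_pXn2r// nnegrE mdist_ge0. Qed.

(** Stewart's inequality is used twice, from [p] to the side [x z] and from [z] to the side [x y];
    everything but [t ^+ 2 * d y z ^+ 2] cancels. *)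
Lemma thales t x y z p q : 0 <= t <= 1 -> between t x y p -> between t x z q ->
  d p q <= t * d y z.
Proof.
move=> t01 xyp xzq; have := stewart p t01 xzq; have := stewart z t01 xyp.
rewrite (metric_sym p x) xyp.1 !(metric_sym z p) (metric_sym z x) (metric_sym z y).
move=> h1 h2; rewrite -(@ler_pXn2r _ 2)// ?nnegrE ?mulr_ge0 ?mdist_ge0//; last first.
  by case/andP: t01.
by case/andP: t01 => t0 t1; nra.
Qed.

(** The diagonal from [x] to [y'] cuts the quadrilateral into two triangles, and [thales] applies to
    each. *)
Lemma dist_convex t x y x' y' p p' : 0 <= t <= 1 ->
  between t x y p -> between t x' y' p' ->
  d p p' <= (1 - t) * d x x' + t * d y y'.
Proof.
move=> t01 xyp xyp'; have xyq := segP x y' t01.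
have h1 := thales t01 xyp xyq.
have t01' : 0 <= 1 - t <= 1 by case/andP: t01 => *; apply/andP; split; lra.
have h2 := thales t01' (between_sym xyq) (between_sym xyp').
have := metric_triangle p (seg x y' t) p'.
by lra.
Qed.

(** Stewart's inequality bounds the distances from [y] and [w] to the midpoint of [x z]; together
    these bound the other diagonal. *)
Lemma quadrilateral x y z w :
  d x z ^+ 2 + d y w ^+ 2 <=
  d x y ^+ 2 + d y z ^+ 2 + d z w ^+ 2 + d w x ^+ 2.
Proof.
have h01 : 0 <= (2^-1 : R) <= 1 by apply/andP; split; lra.
have := segP x z h01; set m := seg _ _ _ => mP.
have h1 := stewart y h01 mP; have h2 := stewart w h01 mP.
have := metric_triangle y m w; rewrite (metric_sym m w) => h3.
have h4 : d y w ^+ 2 <= (d y m + d w m) ^+ 2.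
  by rewrite ler_pXn2r ?nnegrE ?addr_ge0 ?mdist_ge0.
rewrite (metric_sym y x) (metric_sym w z) in h1 h2.
have h5 : 0 <= (d y m - d w m) ^+ 2 by exact: sqr_ge0.
have h6 : d y w ^+ 2 <= 2 * d y m ^+ 2 + 2 * d w m ^+ 2 by nra.
by lra.
Qed.

End CAT0.

(** * Limits along ultrafilters and projections in proper spaces *)

Section MetricLimits.
Variables (R : realType) (X : metricType R).
Implicit Types (x y z p q : X) (A C : set X).
Local Notation d := (@mdist R X).

Lemma metric_closedP A :
  closed A <-> forall x, (forall e : R, 0 < e -> exists2 y, A y & d x y < e) -> A x.
Proof.
split=> [Acl x xA|H x xA]; last first.
  apply: H => e e0.
  have /xA[y [Ay]] : nbhs x (ball x e) by exact: nbhsx_ballx.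
  by rewrite ballEmdist; exists y.
apply: Acl => B /nbhs_ballP[e /= e0 eB].
have [y Ay xy] := xA _ e0.
by exists y; split=> //; apply: eB; rewrite ballEmdist.
Qed.

Lemma closed_lipschitz_le (f : X -> R) (C K : R) : 0 <= C ->
  (forall x y, f x <= f y + C * d x y) -> closed [set x | f x <= K].
Proof.
move=> C0 fL; apply/metric_closedP => x xA /=; apply/ler_addgt0Pl => e e0.
have C1 : 0 < C + 1 by lra.
have [y /= fy xy] := xA (e / (C + 1)) (divr_gt0 e0 C1).
apply: le_trans (fL x y) _.
have : (C + 1) * d x y <= e.
  by rewrite mulrC -ler_pdivlMr// ltW.
by have := mdist_ge0 x y; nra.
Qed.

Section Ultralimits.
Variables (T : Type) (F : set_system T).
Implicit Types u v : T -> X.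

Definition tends u x := forall e : R, 0 < e -> F [set i | d x (u i) < e].

(** Properness gives a cluster point, and an ultrafilter converges to its cluster points. *)
Lemma tends_exists u x (r : R) : proper_space X -> UltraFilter F ->
  F [set i | d x (u i) <= r] -> exists l, tends u l.
Proof.
move=> Xp FU Fr; have FF : ProperFilter F by exact: ultra_proper.
have [l [_ lP]] := Xp x r (u @ F) _ Fr.
exists l => e e0.
case: (@in_ultra_setVsetC _ F [set i | d l (u i) < e] FU) => // FC.
have [] := lP (~` ball l e) (ball l e) _ (nbhsx_ballx _ _ e0).
  by rewrite /fmap /=; apply: filterS FC => i /=; rewrite ballEmdist.
by move=> z [].
Qed.

Hypothesis FF : ProperFilter F.

Lemma tends_le u v x y (K : R) : tends u x -> tends v y ->
  F [set i | d (u i) (v i) <= K] -> d x y <= K.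
Proof.
move=> ux vy FK; apply/ler_addgt0Pl => e e0.
have e2 : 0 < e / 2 by lra.
have [i [/= h [h1 h2]]] := filter_ex (filterI FK (filterI (ux _ e2) (vy _ e2))).
move: h h1 h2 => /= h h1 h2.
have := metric_triangle x (u i) y; have := metric_triangle (u i) (v i) y.
by rewrite (metric_sym (v i)); lra.
Qed.

Lemma tends_ge u v x y (K : R) : tends u x -> tends v y ->
  F [set i | K <= d (u i) (v i)] -> K <= d x y.
Proof.
move=> ux vy FK; apply/ler_addgt0Pl => e e0.
have e2 : 0 < e / 2 by lra.
have [i [/= h [h1 h2]]] := filter_ex (filterI FK (filterI (ux _ e2) (vy _ e2))).
move: h h1 h2 => /= h h1 h2.
have := metric_triangle (u i) x (v i); have := metric_triangle x y (v i).
by rewrite (metric_sym (u i) x); lra.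
Qed.

Lemma tends_closed u x A : closed A -> tends u x -> F [set i | A (u i)] -> A x.
Proof.
move=> /metric_closedP Acl ux FA; apply: Acl => e e0.
by have [i [/= ? ?]] := filter_ex (filterI FA (ux _ e0)); exists (u i).
Qed.

Lemma tends_isometry u x (f : X -> X) : (forall y z, d (f y) (f z) = d y z) ->
  tends u x -> tends (f \o u) (f x).
Proof. by move=> fI ux e e0; apply: filterS (ux _ e0) => i /=; rewrite fI. Qed.

End Ultralimits.
End MetricLimits.

Section Projection.
Variables (R : realType) (X : metricType R).
Hypotheses (X_proper : proper_space X) (X_CAT0 : CAT0 X).
Implicit Types (x y z p q : X) (A C : set X).
Local Notation d := (@mdist R X).

Definition convex C := forall x y p (t : R), C x -> C y -> 0 <= t <= 1 ->
  between t x y p -> C p.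

Definition closed_convex C := [/\ C !=set0, closed C & convex C].

Lemma convex_geodesically_convex C : convex C -> geodesically_convex C.
Proof.
move=> Cc x y Cx Cy; split; first exact: (proj1 X_CAT0).
move=> c cP s /andP[s0 s1].
have [D0|DN0] := eqVneq (d x y) 0.
  have -> : s = 0 by move: s1; rewrite D0; lra.
  by case: cP => ->.
have D0 : 0 < d x y by rewrite lt_neqAle eq_sym DN0 mdist_ge0.
have t01 : 0 <= s / d x y <= 1.
  by rewrite divr_ge0 ?mdist_ge0//= ler_pdivrMr// mul1r.
have := geodesic_between cP t01; rewrite divfK// => /Cc; exact.
Qed.

Lemma convexI A C : convex A -> convex C -> convex (A `&` C).
Proof.
move=> hA hC x y p t [Ax Cx] [Ay Cy] t01 xyp.
by split; [exact: hA xyp|exact: hC xyp].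
Qed.

(** The default [x] is taken only when no nearest point exists, which [proj_exists] excludes under
    [closed_convex]. *)
Definition proj C x : X :=
  xget x [set p | C p /\ forall y, C y -> d x p <= d x y].

(** The points of [C] that nearly realize the infimum generate a filter; a finer ultrafilter
    converges by properness. *)
Lemma proj_exists C x : closed_convex C ->
  exists p, C p /\ forall y, C y -> d x p <= d x y.
Proof.
move=> [[c0 Cc0] Ccl _].
pose D := [set d x y | y in C]; pose i0 := inf D.
have Dlb : has_lbound D by exists 0 => _ [y _ <-]; exact: mdist_ge0.
have Dinf : has_inf D by split=> //; exists (d x c0), c0.
pose B (e : R) := [set y | C y /\ d x y < i0 + e].
have FF : ProperFilter (filter_from [set e : R | 0 < e] B).
  apply: filter_from_proper; last first.
    move=> e e0; have [_ [y Cy <-] ylt] := @inf_adherent _ D e e0 Dinf.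
    by exists y.
  apply: filter_from_filter; first by exists 1 => /=; lra.
  move=> e1 e2 /= e10 e20; exists (Num.min e1 e2); first by rewrite /= lt_min e10.
  move=> y [Cy]; rewrite -ltrBlDl lt_min => /andP[h1 h2].
  by split; split=> //; lra.
have [G [GU FG]] := ultraFilterLemma FF.
have GF : ProperFilter G by exact: ultra_proper.
have GB e : 0 < e -> G (B e) by move=> e0; apply: FG; exists e.
have [||p pP] := @tends_exists _ X _ G id x (i0 + 1) => //.
  by apply: filterS (GB 1 ltr01) => y [_ /ltW].
exists p; split.
  by apply: tends_closed pP _ => //; apply: filterS (GB 1 ltr01) => y [].
move=> y Cy; apply: (@le_trans _ _ i0); last by apply: ge_inf => //; exists y.
apply/ler_addgt0Pl => e e0.
apply: (@tends_le _ _ _ G GF (fun=> x) id) => //.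
  by move=> e' e'0; apply: filterE => i /=; rewrite mdistxx.
by apply: filterS (GB e e0) => z [_ /ltW]; rewrite addrC.
Qed.

Section OneSet.
Variable C : set X.
Hypothesis HC : closed_convex C.

Lemma projP x : C (proj C x) /\ forall y, C y -> d x (proj C x) <= d x y.
Proof.
rewrite /proj; case: xgetP => //= noP.
by have [p pP] := proj_exists x HC; case: (noP p).
Qed.

Lemma proj_in x : C (proj C x). Proof. by case: (projP x). Qed.

Lemma proj_min x y : C y -> d x (proj C x) <= d x y.
Proof. by case: (projP x) => _; apply. Qed.

(** The angle at the projection is at least a right angle: otherwise points just beyond it on the
    segment toward [y] would be nearer to [x]. *)
Lemma proj_sqr x y : C y -> d x (proj C x) ^+ 2 + d (proj C x) y ^+ 2 <= d x y ^+ 2.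
Proof.
move=> Cy; set p := proj C x; rewrite leNgt; apply/negP.
rewrite -subr_gt0; set k := _ - _ => k0.
have [_ _ Cc] := HC.
have tP t : 0 < t -> t <= 1 -> k <= t * d p y ^+ 2.
  move=> t0 t1; have t01 : 0 <= t <= 1 by rewrite ltW.
  have zP := segP X_CAT0 p y t01.
  have Cz := Cc _ _ _ _ (proj_in x) Cy t01 zP.
  have := stewart X_CAT0 x t01 zP.
  have : d x p ^+ 2 <= d x (seg X_CAT0 p y t) ^+ 2.
    by rewrite ler_pXn2r ?nnegrE ?mdist_ge0//; exact: proj_min.
  move=> h1 h2; have : t * k <= t * (t * d p y ^+ 2) by rewrite /k; nra.
  by rewrite ler_pM2l.
have k1 := tP 1 ltr01 (lexx _).
have P0 : 0 < d p y ^+ 2 by lra.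
have P2 : 0 < 2 * d p y ^+ 2 by lra.
(* The ratio [k / (2 * d p y ^+ 2)], at most 1 by [k1], turns [tP] into [k <= k / 2]. *)
have := tP _ (divr_gt0 k0 P2); rewrite ler_pdivrMr// mul1r.
have -> : k / (2 * d p y ^+ 2) * d p y ^+ 2 = k / 2.
  by rewrite invfM -!mulrA mulVf ?gt_eqF// mulr1.
by move=> /(_ ltac:(lra)); lra.
Qed.

Lemma proj_uniq x p : C p -> d x p <= d x (proj C x) -> p = proj C x.
Proof.
move=> Cp le; apply/esym/mdist_positivity; have h := proj_sqr x Cp.
have : d x p ^+ 2 <= d x (proj C x) ^+ 2 by rewrite ler_pXn2r ?nnegrE ?mdist_ge0.
move=> h2; apply/eqP; rewrite -sqrf_eq0 eq_le sqr_ge0 andbT; lra.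
Qed.

Lemma proj_id x : C x -> proj C x = x.
Proof. by move=> Cx; apply/esym/proj_uniq => //; rewrite mdistxx mdist_ge0. Qed.

(** Add the obtuse-angle inequalities at both projections and compare with the quadrilateral
    inequality. *)
Lemma proj_lipschitz x y : d (proj C x) (proj C y) <= d x y.
Proof.
have hx := proj_sqr x (proj_in y); have hy := proj_sqr y (proj_in x).
have := quadrilateral X_CAT0 x y (proj C y) (proj C x).
rewrite (metric_sym (proj C y) (proj C x)) in hy *.
rewrite (metric_sym (proj C x) x) => h; apply: ler_dist2; lra.
Qed.

Lemma dist_proj_lipschitz x y : d x (proj C x) <= d y (proj C y) + 1 * d x y.
Proof.
have := proj_min x (proj_in y); have := metric_triangle x y (proj C y); lra.
Qed.

End OneSet.
End Projection.

(** * Fixed points at infinity *)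

Section Boundary.
Variables (R : realType) (X : metricType R).
Hypotheses (X_proper : proper_space X) (X_CAT0 : CAT0 X).
Variables (G : groupType) (a : G -> X -> X).
Hypothesis a_isom : isometric_action a.
Implicit Types (x y z p q : X) (g : G) (T : set X).
Local Notation d := (@mdist R X).

Lemma act_dist g x y : d (a g x) (a g y) = d x y.
Proof. by case: a_isom => _ _; apply. Qed.

Lemma actM g h x : a (g * h)%g x = a g (a h x).
Proof. by case: a_isom => _ + _; apply. Qed.

Lemma act1 x : a 1%g x = x.
Proof. by case: a_isom => + _ _; apply. Qed.

Lemma actVK g x : a g (a g^-1%g x) = x.
Proof. by rewrite -actM mulgV act1. Qed.

Lemma act_between g (t : R) x y p :
  between t x y p -> between t (a g x) (a g y) (a g p).
Proof. by case=> h1 h2; split; rewrite !act_dist. Qed.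

(** Bounded displacement along [c] keeps every image in the class; the reverse inclusion is this one
    applied to the inverse of [g]. *)
Lemma fixed_ray_class (c : R -> X) : ray c ->
  (forall g, exists K : R, forall t : R, 0 <= t -> d (a g (c t)) (c t) <= K) ->
  fixed_boundary_point a.
Proof.
move=> rc cK; exists (ray_class c); first by exists c.
have sub g : boundary_map (a g) (ray_class c) `<=` ray_class c.
  move=> _ [c' [rc' [K cc']] <-]; split.
    by move=> s t s0 t0; rewrite /= act_dist rc'.
  have [K' K'P] := cK g; exists (K' + K) => t t0 /=.
  apply: le_trans (metric_triangle _ (a g (c t)) _) _.
  by rewrite lerD// ?act_dist ?cc'// metric_sym K'P.
move=> g; apply/seteqP; split; first exact: sub.
move=> c' c'P; exists (a g^-1%g \o c'); last first.
  by apply/funext => t /=; rewrite actVK.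
by apply: (sub g^-1%g); exists c'.
Qed.

Definition bounded_displacement (g : G) T :=
  exists K : R, forall x, T x -> d (a g x) x <= K.

Definition nonevanescent := forall T x0,
  (forall g, bounded_displacement g T) ->
  exists r : R, forall x, T x -> d x0 x <= r.

(* Along an ultrafilter escaping to infinity in [T], the geodesics from [x0] to
   the points of [T] converge to a ray that every [g] moves a bounded amount. *)
Lemma no_fixed_boundary_point_nonevanescent :
  ~ fixed_boundary_point a -> nonevanescent.
Proof.
move=> nofix T x0 TK; apply: contrapT => unb; apply: nofix.
pose B (r : R) := [set x | T x /\ r < d x0 x].
have FF : ProperFilter (filter_from setT B).
  apply: filter_from_proper; last first.
    move=> r _; apply: contrapT => nB; apply: unb; exists r => x Tx.
    by rewrite leNgt; apply/negP => rx; apply: nB; exists x.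
  apply: filter_from_filter; first by exists 0.
  move=> r s _ _; exists (Num.max r s) => // x [Tx].
  by rewrite gt_max => /andP[h1 h2]; split; split.
have [F [FU FB']] := ultraFilterLemma FF.
have FPF : ProperFilter F by exact: ultra_proper.
have FB r : F (B r) by apply: FB'; exists r.
have geoP x y := geo_geodesic X_CAT0 x y.
have : forall t : R, exists l, 0 <= t -> tends F (fun y => geo X_CAT0 x0 y t) l.
  move=> t; have [t0|] := boolP (0 <= t); last by exists x0.
  have [|l lP] := @tends_exists _ X _ F (fun y => geo X_CAT0 x0 y t) x0 t X_proper FU.
    apply: filterS (FB t) => y [_ /ltW ty] /=.
    case: (geoP x0 y) => c0 _ /(_ 0 t); rewrite c0 lexx mdist_ge0 t0 ty => ->//.
    by rewrite sub0r normrN ger0_norm.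
  by exists l.
move=> /choice[c cP]; apply: (@fixed_ray_class c).
  move=> s t s0 t0.
  have E : F [set y | d (geo X_CAT0 x0 y s) (geo X_CAT0 x0 y t) = `|s - t|].
    apply: filterS (filterI (FB s) (FB t)) => y [[_ /ltW sy] [_ /ltW ty]] /=.
    by case: (geoP x0 y) => _ _ ->//; rewrite ?s0 ?t0.
  apply/eqP; rewrite eq_le; apply/andP; split.
  by apply: (tends_le FPF (cP s s0) (cP t t0) _); apply: filterS E => y /= ->.
  by apply: (tends_ge FPF (cP s s0) (cP t t0) _); apply: filterS E => y /= ->.
move=> g; have [K KP] := TK g; exists (d (a g x0) x0 + K) => t t0.
have ug := tends_isometry FPF (act_dist g) (cP t t0).
apply: (tends_le FPF ug (cP t t0)).
(* By convexity of the distance, a point of the geodesic is moved at most as much as its ends [x0]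
   and [y] together. *)
apply: filterS (filterI (FB 0) (FB t)) => y [[Ty y0] [_ ty]] /=.
have t01 : 0 <= t / d x0 y <= 1.
  by rewrite divr_ge0 ?mdist_ge0//= ler_pdivrMr// mul1r ltW.
have := geodesic_between (geoP x0 y) t01; rewrite divfK ?gt_eqF// => b.
apply: le_trans (dist_convex X_CAT0 t01 (act_between g b) b) _.
have := KP y Ty; have := mdist_ge0 (a g x0) x0; have := mdist_ge0 (a g y) y.
by case/andP: t01; move: (t / d x0 y) => u u0 u1; nra.
Qed.

End Boundary.

(** * Minimal invariant closed convex sets *)

Section MinimalSets.
Variables (R : realType) (X : metricType R).
Hypotheses (X_proper : proper_space X) (X_CAT0 : CAT0 X).
Variables (G : groupType) (a : G -> X -> X).
Hypothesis a_isom : isometric_action a.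
Hypothesis a_nonevanescent : nonevanescent a.
(** These play the commuting subgroups. They are later instantiated as a factor with its cofactor,
    and as the whole group with the identity. *)
Variables S S' : set G.
Hypothesis SV : forall g, S g -> S g^-1%g.
Hypothesis SS'C : forall g h, S g -> S' h -> (g * h = h * g)%g.
Hypothesis SS' : forall g, exists s s', [/\ S s, S' s' & g = (s * s')%g].
Implicit Types (x y z p q w : X) (g h : G) (A C M N P : set X) (t : R).
Local Notation d := (@mdist R X).

Let actd := act_dist a_isom.

Lemma act_comm g h x : S g -> S' h -> a g (a h x) = a h (a g x).
Proof. by move=> Sg Sh; rewrite -!(actM a_isom) SS'C. Qed.

Definition stable C :=
  closed_convex C /\ forall g x, S g -> C x -> C (a g x).

Definition minimal M := stable M /\ forall N, stable N -> N `<=` M -> M `<=` N.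

Lemma displacement_lipschitz h x y : d (a h x) x <= d (a h y) y + 2 * d x y.
Proof.
have := metric_triangle (a h x) (a h y) x; have := metric_triangle (a h y) y x.
by rewrite actd (metric_sym y x); lra.
Qed.

Lemma displacement_closed h (K : R) : closed [set x | d (a h x) x <= K].
Proof. by apply: closed_lipschitz_le (displacement_lipschitz h). Qed.

Lemma displacement_convex h (K : R) : convex [set x | d (a h x) x <= K].
Proof.
move=> x y p t /= hx hy t01 xyp.
apply: le_trans (dist_convex X_CAT0 t01 (act_between a_isom h xyp) xyp) _.
by case/andP: t01 => *; nra.
Qed.

Lemma proj_equivariant C g x : stable C -> S g ->
  proj C (a g x) = a g (proj C x).
Proof.
move=> [HC CS] Sg; apply/esym/(proj_uniq X_proper X_CAT0 HC).
  by apply: CS => //; exact: proj_in.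
rewrite actd -(actVK a_isom g (proj C (a g x))) actd.
by apply: proj_min => //; apply: CS; [exact: SV|exact: proj_in].
Qed.

Lemma bounded_of_generators A x0 : (forall g, S g -> bounded_displacement a g A) ->
  (forall g, S' g -> bounded_displacement a g A) ->
  exists r : R, forall x, A x -> d x0 x <= r.
Proof.
move=> hS hS'; apply: a_nonevanescent => g.
have [s [s' [Ss Ss' ->]]] := SS' g.
have [K KP] := hS s Ss; have [K' K'P] := hS' s' Ss'.
exists (K' + K) => x Ax; rewrite (actM a_isom).
apply: le_trans (metric_triangle _ (a s x) _) _.
by rewrite lerD ?actd ?KP ?K'P.
Qed.

(** * Existence of minimal sets by Zorn's lemma *)

Section Existence.
Variable C : set X.
Hypothesis HC : stable C.
Variable x0 : X.
Hypothesis Cx0 : C x0.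

(** Inside [D] each element of [S'] has bounded displacement, which keeps decreasing chains from
    escaping to infinity. *)
Let D := C `&` [set y | forall h, S' h -> d (a h y) y <= d (a h x0) x0].

Lemma stable_restricted_displacement : stable D.
Proof.
have [[Cn Ccl Cc] CS] := HC; split; first split.
- by exists x0; split=> //= h _.
- refine (closedI Ccl _).
  rewrite (_ : mkset _ = \bigcap_(h in S') [set y | d (a h y) y <= d (a h x0) x0])//.
  by apply: closed_bigI => h _; exact: displacement_closed.
- apply: convexI => // x y p t hx hy t01 xyp h Sh.
  exact: (displacement_convex (hx h Sh) (hy h Sh) t01 xyp).
- move=> g x Sg [Cx Dx]; split; first exact: CS.
  by move=> h Sh; rewrite -act_comm// actd; exact: Dx.
Qed.

(** Project [x0] to the members of the chain. By equivariance [S] moves these points no more than it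
    moves [x0], and [D] controls [S']; so they stay bounded and properness yields a common point. *)
Lemma chain_intersection (A : set (set X)) (N0 : set X) : A N0 ->
  (forall N, A N -> stable N /\ N `<=` D) ->
  (forall N N', A N -> A N' -> N `<=` N' \/ N' `<=` N) ->
  stable (\bigcap_(N in A) N).
Proof.
move=> AN0 AP Atot; split; first split; last 2 first.
- move=> x y p t hx hy t01 xyp N AN; have [[[_ _ Nc] _] _] := AP N AN.
  exact: Nc (hx N AN) (hy N AN) t01 xyp.
- move=> g x Sg hx N AN; have [[_ NS] _] := AP N AN.
  by apply: NS => //; exact: hx.
- have [r rP] : exists r : R, forall x, [set proj N x0 | N in A] x -> d x0 x <= r.
    apply: bounded_of_generators => g Sg; exists (d (a g x0) x0) => _ [N AN <-].
      have [Ns _] := AP N AN; rewrite -proj_equivariant//.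
      by case: Ns => Ns _; exact: proj_lipschitz.
    have [[Ns _] ND] := AP N AN.
    by have /ND[_] := proj_in X_proper Ns x0; apply.
  pose B N := N `&` [set x | d x0 x <= r].
  have FF : ProperFilter (filter_from A B).
    apply: filter_from_proper; last first.
      move=> N AN; have [[Ns _] _] := AP N AN.
      exists (proj N x0); split; first exact: proj_in.
      by apply: rP; exists N.
    apply: filter_from_filter; first by exists N0.
    move=> N N' AN AN'; have [NN'|N'N] := Atot N N' AN AN'.
      by exists N => // x [Nx xr]; split; split=> //; exact: NN'.
    by exists N' => // x [Nx xr]; split; split=> //; exact: N'N.
  have [F [FU FB']] := ultraFilterLemma FF.
  have FPF : ProperFilter F by exact: ultra_proper.
  have FB N : A N -> F (B N) by move=> AN; apply: FB'; exists N.
  have [|l lP] := @tends_exists _ X _ F id x0 r X_proper FU.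
    by apply: filterS (FB _ AN0) => x [].
  exists l => N AN; have [[[_ Ncl _] _] _] := AP N AN.
  by apply: (tends_closed FPF Ncl lP); apply: filterS (FB _ AN) => x [].
- by apply: closed_bigI => N AN; have [[[]]] := AP N AN.
Qed.

Lemma minimal_exists : exists2 M, minimal M & M `<=` C.
Proof.
pose T := {N : set X | stable N /\ N `<=` D}.
(* Reverse inclusion, so that a maximal element is a minimal set. *)
pose le (N N' : T) := `[< sval N' `<=` sval N >].
have DP := stable_restricted_displacement.
have [||||M MP] := @Zorn T le.
- by move=> N; apply/asboolP.
- by move=> N1 N2 N3 /asboolP h1 /asboolP h2; apply/asboolP => x /h2/h1.
- move=> [N1 N1P] [N2 N2P] /asboolP h1 /asboolP h2; apply: eq_exist.
  by apply/seteqP; split.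
- move=> A Atot; have [[N0 AN0]|A0] := pselect (A !=set0); last first.
    (* The empty chain is bounded by [D]. *)
    exists (exist _ D (conj DP (@subset_refl _ D)) : T) => N AN.
    by case: A0; exists N.
  pose A' := [set sval N | N in A].
  have sI : stable (\bigcap_(N in A') N).
    apply: (@chain_intersection A' (sval N0)); first by exists N0.
      by move=> _ [N AN <-]; exact: (svalP N).
    move=> _ _ [N AN <-] [N' AN' <-].
    by case: (Atot N N' AN AN') => /asboolP h; [right|left].
  have ID : \bigcap_(N in A') N `<=` D.
    by move=> x /(_ (sval N0)) h; apply: (svalP N0).2; apply: h; exists N0.
  exists (exist _ (\bigcap_(N in A') N) (conj sI ID) : T) => N AN; apply/asboolP => /= x; apply.
  by exists N.
exists (sval M); last by move=> x /(svalP M).2[].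
split; first exact: (svalP M).1.
move=> N Ns NM; have ND : N `<=` D by move=> x /NM/(svalP M).2.
have := MP (exist _ N (conj Ns ND) : T) => h.
by have <- : N = sval M by rewrite -h//; apply/asboolP.
Qed.

End Existence.

(** Induction principle for minimal sets: a closed, convex, [S]-invariant condition that holds at
    one point cuts out a stable subset, hence all of [M]. *)
Lemma minimal_sub M P x0 : minimal M -> closed (M `&` P) -> convex (M `&` P) ->
  (forall g x, S g -> M x -> P x -> P (a g x)) -> M x0 -> P x0 -> M `<=` P.
Proof.
move=> [[_ MS] Mm] Pcl Pc PS Mx0 Px0.
have MP : stable (M `&` P).
  split; first by split=> //; exists x0.
  by move=> g x Sg [Mx Px]; split; [exact: MS|exact: PS].
by apply: subset_trans (Mm _ MP (@subIsetl _ _ _)) _; exact: subIsetr.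
Qed.

Lemma minimal_closed_convex M : minimal M -> closed_convex M.
Proof. by case=> [[]]. Qed.

Lemma minimal_stable M : minimal M -> stable M.
Proof. by case. Qed.

Lemma minimal_act M g x : minimal M -> S g -> M x -> M (a g x).
Proof. by case=> [[_ MS] _] Sg; exact: MS. Qed.

Lemma minimal_mid M x y t : minimal M -> M x -> M y -> 0 <= t <= 1 ->
  M (seg X_CAT0 x y t).
Proof.
move=> [[[_ _ Mc] _] _] Mx My t01; apply: (Mc _ _ _ _ Mx My t01); exact: segP.
Qed.

(** Sublevel sets of the displacement of [h] are [S]-invariant because [h] commutes with [S].
    Exchanging [x] and [y] gives equality. *)
Lemma displacement_constant M h x y : minimal M -> S' h -> M x -> M y ->
  d (a h y) y <= d (a h x) x.
Proof.
move=> Mm Sh Mx; move: y; have [[[_ Mcl Mc] _] _] := Mm.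
apply: (@minimal_sub M [set y | d (a h y) y <= d (a h x) x] x) => //.
- by refine (closedI Mcl _); exact: displacement_closed.
- by apply: convexI => //; exact: displacement_convex.
- by move=> g z Sg Mz; rewrite /= -act_comm// actd.
- exact: lexx.
Qed.

(** * Images of a minimal set under equivariant isometric embeddings *)

Section Transport.
Variables (M : set X) (phi : X -> X).
Hypothesis Mm : minimal M.
Hypothesis phi_isom : forall x y, M x -> M y -> d (phi x) (phi y) = d x y.
Hypothesis phi_equiv : forall g x, S g -> M x -> phi (a g x) = a g (phi x).

Lemma isometry_between t x y p : M x -> M y -> M p ->
  between t x y p -> between t (phi x) (phi y) (phi p).
Proof. by move=> Mx My Mp [h1 h2]; split; rewrite !phi_isom. Qed.

(** Preimages of points converging to [p] stay bounded because [phi] is isometric, so they have a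
    limit in [M], which maps to [p]. *)
Lemma minimal_image_closed : closed (phi @` M).
Proof.
have [_ Mcl _] := minimal_closed_convex Mm.
apply/metric_closedP => p pP.
pose B (e : R) := [set x | M x /\ d p (phi x) < e].
have FF : ProperFilter (filter_from [set e : R | 0 < e] B).
  apply: filter_from_proper; last first.
    by move=> e e0; have [_ [x Mx <-] px] := pP e e0; exists x.
  apply: filter_from_filter; first by exists 1 => /=; lra.
  move=> e1 e2 /= e10 e20; exists (Num.min e1 e2); first by rewrite /= lt_min e10.
  by move=> y [My]; rewrite lt_min => /andP[h1 h2]; split.
have [F [FU FB']] := ultraFilterLemma FF.
have FPF : ProperFilter F by exact: ultra_proper.
have FB e : 0 < e -> F (B e) by move=> e0; apply: FB'; exists e.
have [_ [x1 Mx1 <-] px1] := pP 1 ltr01.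
have [|l lP] := @tends_exists _ X _ F id x1 2 X_proper FU.
  apply: filterS (FB 1 ltr01) => x [Mx px] /=; rewrite -phi_isom//.
  have := metric_triangle (phi x1) p (phi x); rewrite (metric_sym _ p); lra.
have Ml : M l.
  by apply: (tends_closed FPF Mcl lP); apply: filterS (FB 1 ltr01) => x [].
exists l => //; apply/mdist_positivity/eqP; rewrite eq_le mdist_ge0 andbT.
apply/ler_addgt0Pl => e e0; have e2 : 0 < e / 2 by lra.
have [x [[Mx px] xl]] := filter_ex (filterI (FB _ e2) (lP _ e2)).
have := metric_triangle (phi l) (phi x) p; rewrite phi_isom//.
by move: xl => /=; rewrite (metric_sym (phi x) p); lra.
Qed.

(** A stable subset of the image pulls back to a stable subset of [M]. *)
Lemma minimal_image : minimal (phi @` M).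
Proof.
have [[[Mn Mcl Mc] MS] Mmin] := Mm.
split; first split; first split.
- by case: Mn => x Mx; exists (phi x), x.
- exact: minimal_image_closed.
- move=> _ _ p t [x Mx <-] [y My <-] t01 xyp.
  have Mq := minimal_mid Mm Mx My t01.
  exists (seg X_CAT0 x y t) => //.
  apply: (between_uniq X_CAT0 t01) xyp; apply: isometry_between => //.
  exact: segP.
- by move=> g _ Sg [x Mx <-]; exists (a g x); [exact: MS|rewrite phi_equiv].
move=> N [[[y0 Ny0] Ncl Nc] NS] NM.
have [x0 Mx0 x0y] := NM _ Ny0.
suff h : M `<=` [set x | N (phi x)] by move=> _ [x Mx <-]; exact: h.
apply: (@minimal_sub _ _ x0) => //=; last 2 first.
- by move=> g x Sg Mx Nx; rewrite /= phi_equiv//; exact: NS.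
- by rewrite x0y.
- apply/metric_closedP => x xP.
  have Mx : M x.
    by apply: ((metric_closedP M).1 Mcl) => e /xP[y [My _] xy]; exists y.
  split=> //=; apply: ((metric_closedP N).1 Ncl) => e /xP[y [My Ny] xy].
  by exists (phi y) => //; rewrite phi_isom.
- move=> x y p t [Mx Nx] [My Ny] t01 xyp.
  have Mp := Mc _ _ _ _ Mx My t01 xyp; split=> //=.
  by apply: Nc Nx Ny t01 _; exact: isometry_between.
Qed.

End Transport.

Lemma minimal_act_image M h : minimal M -> S' h -> minimal (a h @` M).
Proof.
move=> Mm Sh; apply: minimal_image => // g x Sg _.
by rewrite (act_comm _ Sg Sh).
Qed.

(** * Parallelism of two minimal sets *)

Section Pair.
Variables M M' : set X.
Hypotheses (Mm : minimal M) (M'm : minimal M').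

Let HM := minimal_closed_convex Mm.
Let HM' := minimal_closed_convex M'm.

(** The distance to [M'] is convex and [S]-invariant, so [minimal_sub] applies to its sublevel
    sets. *)
Lemma dist_proj_constant x y : M x -> M y ->
  d y (proj M' y) = d x (proj M' x).
Proof.
suff le x' y' : M x' -> M y' -> d y' (proj M' y') <= d x' (proj M' x').
  by move=> Mx My; apply/eqP; rewrite eq_le !le.
move=> Mx'; move: y'; have [[[_ Mcl Mc] _] _] := Mm.
apply: (@minimal_sub M [set y | d y (proj M' y) <= d x' (proj M' x')] x') => //.
- refine (closedI Mcl _); apply: (@closed_lipschitz_le _ _ _ 1) => // y1 y2.
  exact: dist_proj_lipschitz.
- apply: convexI => // y1 y2 p t /= h1 h2 t01 yp.
  have [_ _ M'c] := HM'.
  have M'y k : M' (proj M' k) by exact: proj_in.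
  have qP := segP X_CAT0 (proj M' y1) (proj M' y2) t01.
  apply: le_trans (proj_min X_proper HM' p (M'c _ _ _ _ (M'y _) (M'y _) t01 qP)) _.
  apply: le_trans (dist_convex X_CAT0 t01 yp qP) _.
  by case/andP: t01 => *; nra.
- move=> g y0 Sg My /=.
  by rewrite (proj_equivariant _ (minimal_stable M'm) Sg) actd.
- exact: lexx.
Qed.

(** All points of [M] are equally far from [M'], so no point of [M] is nearer than [x] to the
    projection of [x]. *)
Lemma proj_projK x : M x -> proj M (proj M' x) = x.
Proof.
move=> Mx; apply/esym/(proj_uniq X_proper X_CAT0 HM) => //.
have Mp : M (proj M (proj M' x)) by exact: proj_in.
rewrite (metric_sym _ x) -(dist_proj_constant Mx Mp) (metric_sym (proj M' x)).
by apply: proj_min => //; exact: proj_in.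
Qed.

Lemma proj_isometry x y : M x -> M y -> d (proj M' x) (proj M' y) = d x y.
Proof.
move=> Mx My; apply/eqP; rewrite eq_le proj_lipschitz//=.
by rewrite -{1}(proj_projK Mx) -{1}(proj_projK My) proj_lipschitz.
Qed.

End Pair.

Lemma proj_act M g x : minimal M -> S g -> proj M (a g x) = a g (proj M x).
Proof. by move=> Mm; apply: proj_equivariant; exact: minimal_stable. Qed.

Lemma proj_in_minimal M x : minimal M -> M (proj M x).
Proof. by move=> Mm; apply: proj_in => //; exact: minimal_closed_convex. Qed.

Section Parallel.
Variables M M' : set X.
Hypotheses (Mm : minimal M) (M'm : minimal M').

Let HM := minimal_closed_convex Mm.
Let HM' := minimal_closed_convex M'm.

(** One inequality is the obtuse angle at [proj M' x]. The other is the quadrilateral inequality for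
    [x], [proj M' x], [y'], [proj M y'], whose opposite sides are equal, with the obtuse angle at
    [x] bounding the second diagonal. *)
Lemma pythagoras x y' : M x -> M' y' ->
  d x y' ^+ 2 = d x (proj M' x) ^+ 2 + d (proj M' x) y' ^+ 2.
Proof.
move=> Mx My'; apply/eqP; rewrite eq_le (proj_sqr X_proper X_CAT0 HM')// andbT.
set y := proj M y'; have My : M y by exact: proj_in_minimal.
have yE : proj M' y = y' by exact: proj_projK.
have h1 := quadrilateral X_CAT0 x (proj M' x) y' y.
have h2 := proj_sqr X_proper X_CAT0 HM (proj M' x) My.
rewrite proj_projK// in h2.
have h3 := dist_proj_constant Mm M'm Mx My; rewrite yE in h3.
have h4 := proj_isometry Mm M'm Mx My; rewrite yE in h4.
rewrite (metric_sym y' y) h3 (metric_sym y x) -h4 in h1.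
rewrite (metric_sym (proj M' x) x) -h4 in h2.
by lra.
Qed.

End Parallel.

(** * The flat strip between two minimal sets *)

Section Slices.
Variables M M' : set X.
Hypotheses (Mm : minimal M) (M'm : minimal M').

Let HM := minimal_closed_convex Mm.
Let HM' := minimal_closed_convex M'm.

Section Slice.
Variable t : R.
Hypothesis t01 : 0 <= t <= 1.

Definition slice x := seg X_CAT0 x (proj M' x) t.

Lemma slice_between x : between t x (proj M' x) (slice x).
Proof. exact: segP. Qed.

(** A point of [M] nearer to the slice point than [x] would be closer to [M'] than the constant
    distance. *)
Lemma proj_slice x : M x -> proj M (slice x) = x.
Proof.
move=> Mx; apply/esym/(proj_uniq X_proper X_CAT0 HM) => //.
have Mm' := proj_in_minimal (slice x) Mm.
have [h1 h2] := slice_between x.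
have h3 := dist_proj_constant Mm M'm Mx Mm'.
have h4 := proj_min X_proper HM' (proj M (slice x)) (proj_in_minimal x M'm).
have := metric_triangle (proj M (slice x)) (slice x) (proj M' x).
by rewrite (metric_sym (slice x) x) (metric_sym (slice x) (proj M _)); lra.
Qed.

Lemma slice_minimal : minimal (slice @` M).
Proof.
apply: minimal_image => //.
  move=> x y Mx My; apply/eqP; rewrite eq_le; apply/andP; split.
    apply: le_trans (dist_convex X_CAT0 t01 (slice_between x) (slice_between y)) _.
    by rewrite (proj_isometry Mm M'm)//; lra.
  by rewrite -{1}(proj_slice Mx) -{1}(proj_slice My) proj_lipschitz.
move=> g x Sg Mx; apply: (between_uniq X_CAT0 t01 (slice_between _)).
by rewrite proj_act//; apply: act_between => //; exact: slice_between.
Qed.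

Lemma proj_onto_slice x : M x -> proj (slice @` M) x = slice x.
Proof.
move=> Mx; rewrite -{1}(proj_slice Mx).
by apply: (proj_projK slice_minimal Mm); exists x.
Qed.

Lemma proj_onto_slice' x : M x -> proj (slice @` M) (proj M' x) = slice x.
Proof.
move=> Mx; have Nm := slice_minimal.
have HN := minimal_closed_convex Nm.
apply/esym/(proj_uniq X_proper X_CAT0 HN); first by exists x.
have [z Mz zE] := proj_in_minimal (proj M' x) Nm; rewrite -zE.
have [h1 h2] := slice_between x; have [h3 h4] := slice_between z.
have h5 := dist_proj_constant Mm M'm Mx Mz.
have := proj_min X_proper HM (proj M' x) Mz; rewrite proj_projK//.
have := metric_triangle (proj M' x) (slice z) z.
rewrite (metric_sym (slice z) z) (metric_sym _ x) (metric_sym (proj M' x) (slice x)).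
by rewrite h3 h5; lra.
Qed.

End Slice.

(** By [pythagoras] in the strip, the slice point over the point of [M] at ratio [t] has the
    distances to [x] and [y'] required of [p]; uniqueness identifies the two. *)
Lemma minimal_segment x y' p t : M x -> M' y' -> 0 <= t <= 1 ->
  between t x y' p ->
  exists N, [/\ minimal N, N p & between t x (proj M y') (proj M p)].
Proof.
move=> Mx My' t01 xyp; set y := proj M y'.
have My : M y by exact: proj_in_minimal.
have yE : proj M' y = y' by exact: proj_projK.
have uP := segP X_CAT0 x y t01; set u := seg X_CAT0 x y t in uP.
have Mu : M u by exact: minimal_mid.
have Nm := slice_minimal t01.
have Nu : (slice t @` M) (slice t u) by exists u.
suff <- : slice t u = p by exists (slice t @` M); rewrite proj_slice.
have E := pythagoras Mm M'm Mx My'.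
have [t0 t1] := andP t01.
have [u1 u2] := uP.
have iso := proj_isometry Mm M'm Mx My; rewrite yE in iso.
have yc := dist_proj_constant Mm M'm Mx My; rewrite yE in yc.
have sliceI v w : M v -> M w -> d (slice t v) (slice t w) = d v w.
  by move=> Mv Mw; rewrite -(proj_isometry Mm Nm Mv Mw) !proj_onto_slice.
have [sx1 _] := slice_between t01 x; have [_ sy2] := slice_between t01 y.
rewrite yE yc in sy2.
have e1 : d x (slice t u) ^+ 2 = (t * d x y') ^+ 2.
  rewrite (pythagoras Mm Nm Mx Nu) proj_onto_slice// sliceI// sx1 u1 !exprMn E iso.
  by ring.
have e2 : d (slice t u) y' ^+ 2 = ((1 - t) * d x y') ^+ 2.
  rewrite (metric_sym _ y') (pythagoras M'm Nm My' Nu).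
  have -> : proj (slice t @` M) y' = slice t y by rewrite -yE proj_onto_slice'.
  rewrite sliceI// (metric_sym y') sy2 (metric_sym y u) u2.
  by rewrite !exprMn E iso; ring.
apply: (between_uniq X_CAT0 t01 _ xyp).
split; apply/eqP; rewrite -(@eqrXn2 _ 2)// ?mulr_ge0 ?mdist_ge0 ?subr_ge0//.
  by rewrite e1.
by rewrite e2.
Qed.
End Slices.

(* The displacement of [phi] is a constant [c] on [M], and convexity doubles it
   under squaring; so [c > 0] makes the iterates [phi ^ (2 ^ k)] unbounded. *)
Lemma rigidity M (phi : X -> X) : minimal M -> (forall x, M x -> M (phi x)) ->
  (forall x y, M x -> M y -> d (phi x) (phi y) = d x y) ->
  (forall g x, S g -> M x -> phi (a g x) = a g (phi x)) ->
  forall x, M x -> phi x = x.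
Proof.
move=> Mm; have [[[_ Mcl Mc] MS] _] := Mm.
(* Here [c] is only a lower bound for the displacement; this is what passes to squares. *)
pose good (phi : X -> X) (c : R) :=
  [/\ forall x, M x -> M (phi x),
      forall x y, M x -> M y -> d (phi x) (phi y) = d x y,
      forall g x, S g -> M x -> phi (a g x) = a g (phi x) &
      forall x, M x -> c <= d x (phi x)].
have disp psi c x y : good psi c -> M x -> M y -> d y (psi y) <= d x (psi x).
  move=> [psiM psiI psiS _] Mx; move: y.
  apply: (@minimal_sub M [set y | d y (psi y) <= d x (psi x)] x) => //.
  - apply/metric_closedP => y yP.
    have My : M y.
      by apply: ((metric_closedP M).1 Mcl) => e /yP[z [Mz _] yz]; exists z.
    split=> //=; apply/ler_addgt0Pl => e e0.
    have [|z [Mz /= zP] yz] := yP (e / 2); first by lra.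
    have := metric_triangle y z (psi y); have := metric_triangle z (psi z) (psi y).
    by rewrite (psiI _ _ Mz My) (metric_sym z y); lra.
  - move=> y z p t [My /= yP] [Mz /= zP] t01 yzp.
    have Mp := Mc _ _ _ _ My Mz t01 yzp; split=> //=.
    have pP := isometry_between psiI My Mz Mp yzp.
    apply: le_trans (dist_convex X_CAT0 t01 yzp pP) _.
    by case/andP: t01 => *; nra.
  - by move=> g y Sg My /=; rewrite psiS// actd.
  - exact: lexx.
have double psi c : good psi c -> good (psi \o psi) (2 * c).
  move=> [psiM psiI psiS psic]; split=> /=.
  - by move=> x Mx; exact: (psiM _ (psiM _ Mx)).
  - by move=> x y Mx My; rewrite !psiI//; exact: psiM.
  - by move=> g x Sg Mx; rewrite !psiS//; exact: psiM.
  - move=> x Mx; have Mpx := psiM _ Mx.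
    (* With [m] the midpoint of [x] and [psi x], [thales] at the vertex [psi x] bounds the
       displacement of [m] by half of that of [x] under [psi \o psi]. *)
    have h01 : 0 <= (2^-1 : R) <= 1 by apply/andP; split; lra.
    have mP := segP X_CAT0 x (psi x) h01; set m := seg _ _ _ _ in mP.
    have Mm' : M m by exact: minimal_mid.
    have pmP := isometry_between psiI Mx Mpx Mm' mP.
    have := thales X_CAT0 h01 _ pmP.
    have := between_sym mP; rewrite (_ : 1 - 2^-1 = 2^-1 :> R); last by lra.
    move=> mP' /(_ _ _ mP').
    by have := psic m Mm'; lra.
move=> phiM phiI phiS x0 Mx0; apply/esym/mdist_positivity/eqP.
set c := d x0 (phi x0); rewrite eq_le mdist_ge0 andbT leNgt; apply/negP => c0.
have phi_good : good phi c.
  split=> // x Mx; apply: (@disp phi 0) => //; split=> // y My; exact: mdist_ge0.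
pose psi k := iter k (fun f => f \o f) phi.
have psi_good k : good (psi k) (2 ^+ k * c).
  elim: k => [|k IH]; first by rewrite expr0 mul1r.
  by rewrite exprS -mulrA; exact: double.
have psiM k : M (psi k x0) by case: (psi_good k) => + _ _ _; apply.
(* On these iterates [S] has constant displacement since it commutes with [psi k], and [S'] since
   they all lie in [M]; so they are bounded. *)
have [||r rP] := @bounded_of_generators (range (fun k => psi k x0)) x0.
- move=> g Sg; exists (d (a g x0) x0) => _ [k _ <-].
  by case: (psi_good k) => _ kI kS _; rewrite -kS// kI//; exact: MS.
- move=> h Sh; exists (d (a h x0) x0) => _ [k _ <-].
  exact: (displacement_constant Mm Sh Mx0 (psiM k)).
have pow k : k%:R <= 2 ^+ k :> R.
  by rewrite -natrX ler_nat ltnW// ltn_expl.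
have [k kP] : exists k : nat, r / c < k%:R.
  by exists (Num.truncn (r / c)).+1; rewrite truncnS_gt.
have : 2 ^+ k * c <= r.
  apply: le_trans (rP _ _); last by exists k.
  by case: (psi_good k) => _ _ _; apply.
rewrite leNgt => /negP; apply.
by rewrite -ltr_pdivrMr//; exact: lt_le_trans kP (pow k).
Qed.

(** * The union of the minimal sets and its product structure *)

Definition leaves : set X := [set p | exists2 M, minimal M & M p].

(* The loop M -> N -> M' -> M of projections commutes with [S]. *)
Lemma proj_proj_leaf M M' p : minimal M -> minimal M' -> leaves p ->
  proj M (proj M' p) = proj M p.
Proof.
move=> Mm M'm [N Nm Np].
pose phi x := proj M (proj M' (proj N x)).
have N_ x : N (proj N x) by exact: proj_in_minimal.
have M'_ x : M' (proj M' x) by exact: proj_in_minimal.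
have M_ x : M (proj M x) by exact: proj_in_minimal.
have := @rigidity M phi Mm _ _ _ (proj M p) (M_ _).
rewrite /phi (proj_projK Nm Mm Np); apply=> //.
- move=> x y Mx My.
  by rewrite (proj_isometry M'm Mm)// (proj_isometry Nm M'm)// (proj_isometry Mm Nm).
- by move=> g x Sg Mx; rewrite !proj_act.
Qed.

(** The loop M -> N -> hN -> M, whose middle arrow is [a h], commutes with [S] and is the identity
    by [rigidity]. *)
Lemma proj_complement M p h : minimal M -> leaves p -> S' h ->
  proj M (a h p) = proj M p.
Proof.
move=> Mm [N Nm Np] Sh.
have hNm := minimal_act_image Nm Sh.
pose phi x := proj M (a h (proj N x)).
have N_ x : N (proj N x) by exact: proj_in_minimal.
have M_ x : M (proj M x) by exact: proj_in_minimal.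
have := @rigidity M phi Mm _ _ _ (proj M p) (M_ _).
rewrite /phi (proj_projK Nm Mm Np); apply=> //.
- move=> x y Mx My; rewrite (proj_isometry hNm Mm) ?actd.
  + exact: (proj_isometry Mm Nm).
  + by exists (proj N x).
  + by exists (proj N y).
- by move=> g x Sg Mx; rewrite (proj_act x Nm Sg) -(act_comm _ Sg Sh) (proj_act _ Mm Sg).
Qed.

Lemma leaves_convex : convex leaves.
Proof.
move=> x y p t [M Mm Mx] [M' M'm M'y] t01 xyp.
by have [N [Nm Np _]] := minimal_segment Mm M'm Mx M'y t01 xyp; exists N.
Qed.

Lemma leaves_act g p : leaves p -> leaves (a g p).
Proof.
have [s [s' [Ss Ss' ->]]] := SS' g; move=> [M Mm Mp].
have hMm := minimal_act_image Mm Ss'; exists (a s' @` M) => //.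
by rewrite (actM a_isom); apply: minimal_act hMm Ss _; exists p.
Qed.

(** [minimal_segment] gives the claim for the leaf [N] through [x]; by [proj_proj_leaf] projecting
    to [M] factors through [N], where it is isometric. *)
Lemma proj_affine M x y p t : minimal M -> leaves x -> leaves y -> 0 <= t <= 1 ->
  between t x y p -> between t (proj M x) (proj M y) (proj M p).
Proof.
move=> Mm Lx Ly t01 xyp; have Lp := leaves_convex Lx Ly t01 xyp.
move: (Lx) (Ly) => [N Nm Nx] [N' N'm N'y].
have [_ [_ _ pP]] := minimal_segment Nm N'm Nx N'y t01 xyp.
rewrite -(proj_proj_leaf Mm Nm Lp) -(proj_proj_leaf Mm Nm Ly).
have N_ z : N (proj N z) by exact: proj_in_minimal.
by apply: (@isometry_between N) => //; exact: proj_isometry.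
Qed.

(** The last term is the distance between the parallel leaves [N] and [N'], read off at the base
    point [m]. *)
Lemma leaf_product M N N' m z w : minimal M -> minimal N -> minimal N' ->
  leaves m -> N z -> N' w ->
  d z w ^+ 2 = d (proj M z) (proj M w) ^+ 2 + d (proj N m) (proj N' m) ^+ 2.
Proof.
move=> Mm Nm N'm Lm Nz N'w; rewrite (pythagoras Nm N'm Nz N'w) addrC.
have Nm' := proj_in_minimal m Nm.
have N'z := proj_in_minimal z N'm.
have Lz : leaves z by exists N.
rewrite -(dist_proj_constant Nm N'm Nz Nm') (proj_proj_leaf N'm Nm Lm).
by rewrite -(proj_isometry N'm Mm N'z N'w) (proj_proj_leaf Mm N'm Lz).
Qed.

(** As leaves pass through points [q] tending to [p], the projections of a fixed [M] onto them
    converge to an equivariant isometric embedding [psi], whose image is minimal and contains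
    [p]. *)
Lemma leaves_closed : closed leaves.
Proof.
apply/metric_closedP => p pP.
have [q0 [M Mm _] _] := pP 1 ltr01.
pose B (e : R) := [set q | leaves q /\ d p q < e].
have FF : ProperFilter (filter_from [set e : R | 0 < e] B).
  apply: filter_from_proper; last first.
    by move=> e e0; have [q Lq pq] := pP e e0; exists q.
  apply: filter_from_filter; first by exists 1 => /=; lra.
  move=> e1 e2 /= e10 e20; exists (Num.min e1 e2); first by rewrite /= lt_min e10.
  by move=> y [Ly]; rewrite lt_min => /andP[h1 h2]; split.
have [F [FU FB']] := ultraFilterLemma FF.
have FPF : ProperFilter F by exact: ultra_proper.
have FB e : 0 < e -> F (B e) by move=> e0; apply: FB'; exists e.
have FL : F leaves by apply: filterS (FB 1 ltr01) => q [].
have /choice[N NP] : forall q, exists N, leaves q -> minimal N /\ N q.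
  move=> q; have [[N Nm Nq]|nL] := pselect (leaves q); first by exists N.
  by exists set0.
have dq q z : leaves q -> d q (proj (N q) z) <= d q z.
  move=> Lq; have [Nm Nq] := NP q Lq; have HN := minimal_closed_convex Nm.
  by rewrite -{1}(proj_id X_proper X_CAT0 HN Nq) proj_lipschitz.
have /choice[psi psiP] : forall z, exists l, tends F (fun q => proj (N q) z) l.
  move=> z; apply: (@tends_exists _ X _ F _ p (1 + (d p z + 1))) => //.
  apply: filterS (FB 1 ltr01) => q [Lq pq] /=.
  have := dq q z Lq; have := metric_triangle p q (proj (N q) z).
  by have := metric_triangle q p z; rewrite (metric_sym q p); lra.
have psiI x y : M x -> M y -> d (psi x) (psi y) = d x y.
  move=> Mx My; have E : F [set q | d (proj (N q) x) (proj (N q) y) = d x y].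
    apply: filterS FL => q Lq /=; have [Nm _] := NP q Lq.
    exact: (proj_isometry Mm Nm Mx My).
  apply/eqP; rewrite eq_le; apply/andP; split.
    by apply: (tends_le FPF (psiP x) (psiP y)); apply: filterS E => q /= ->.
  by apply: (tends_ge FPF (psiP x) (psiP y)); apply: filterS E => q /= ->.
have psiS g x : S g -> M x -> psi (a g x) = a g (psi x).
  move=> Sg Mx; apply/mdist_positivity/eqP; rewrite eq_le mdist_ge0 andbT.
  have gx := tends_isometry FPF (actd g) (psiP x).
  apply: (tends_le FPF (psiP (a g x)) gx).
  apply: filterS FL => q Lq /=; have [Nm _] := NP q Lq.
  by rewrite proj_act// mdistxx.
exists (psi @` M); first exact: minimal_image.
exists (proj M p); first exact: proj_in_minimal.
apply/mdist_positivity/eqP; rewrite eq_le mdist_ge0 andbT.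
apply/ler_addgt0Pl => e e0.
have idp : tends F id p by move=> r r0; apply: filterS (FB r r0) => q [].
apply: (tends_le FPF (psiP (proj M p)) idp).
apply: filterS (FB e e0) => q [Lq pq] /=; rewrite addr0.
have [Nm Nq] := NP q Lq.
(* Since [q] is the image of [proj M q] in its leaf, the Lipschitz bounds reduce the claim to
   [d p q < e]. *)
rewrite -{2}(proj_projK Nm Mm Nq) ltW//; apply: le_lt_trans pq.
apply: le_trans (proj_lipschitz X_proper X_CAT0 (minimal_closed_convex Nm) _ _) _.
exact: (proj_lipschitz X_proper X_CAT0 (minimal_closed_convex Mm)).
Qed.

End MinimalSets.

Section Induced.
Variables (R : realType) (X : metricType R) (M : set X).

(** Membership is boolean so that points with equal values are equal. *)
Definition induced : Type := {x : X | x \in M}.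

HB.instance Definition _ := Choice.copy induced {x : X | x \in M}.

Definition induced_dist (x y : induced) : R := mdist (sval x) (sval y).

Let distxx x : induced_dist x x = 0. Proof. exact: mdistxx. Qed.
Let dist_positivity x y : induced_dist x y = 0 -> x = y.
Proof. by move=> /mdist_positivity h; apply/val_inj. Qed.
Let dist_sym x y : induced_dist x y = induced_dist y x.
Proof. exact: metric_sym. Qed.
Let dist_triangle y x z : induced_dist x z <= induced_dist x y + induced_dist y z.
Proof. exact: metric_triangle. Qed.

HB.instance Definition _ := isMetric.Build R induced
  distxx dist_positivity dist_sym dist_triangle.
End Induced.

(** * Splitting along a product of groups *)

Section Factors.
Variables (n : nat) (G : 'I_n -> groupType).
Implicit Types (i j : 'I_n) (g h : prodG G).

Definition factor i : set (prodG G) := [set g | forall j, i != j -> g j = 1%g].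
Definition cofactor i : set (prodG G) := [set g | g i = 1%g].
Definition factor_in i (x : G i) : prodG G := dfwith (fun j => 1%g : G j) x.

Lemma factor_inP i (x : G i) : factor i (factor_in x).
Proof. by move=> j ij; rewrite /factor_in dfwith_out. Qed.

Lemma factorV i g : factor i g -> factor i g^-1%g.
Proof. by move=> gi j ij; rewrite -[LHS]/((g j)^-1)%g gi// invg1. Qed.

Lemma factor_comm i g h : factor i g -> cofactor i h -> (g * h = h * g)%g.
Proof.
move=> gi hi; apply: functional_extensionality_dep => j.
rewrite -[LHS]/(g j * h j)%g -[RHS]/(h j * g j)%g.
have [<-|ij] := eqVneq i j; first by rewrite hi mulg1 mul1g.
by rewrite gi// mulg1 mul1g.
Qed.

Lemma factor_decomp i g : let h := dfwith g (1%g : G i) in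
  cofactor i h /\ g = (factor_in (g i) * h)%g.
Proof.
split; first by rewrite /cofactor /= dfwith_in.
apply: functional_extensionality_dep => j.
rewrite -[RHS]/(factor_in (g i) j * dfwith g (1%g : G i) j)%g.
have [<-|ij] := eqVneq i j; first by rewrite /factor_in !dfwith_in mulg1.
by rewrite /factor_in !dfwith_out// mul1g.
Qed.

Lemma factor_inM i (x y : G i) : factor_in (x * y)%g = (factor_in x * factor_in y)%g.
Proof.
apply: functional_extensionality_dep => j.
rewrite -[RHS]/(factor_in x j * factor_in y j)%g /factor_in.
have [<-|ij] := eqVneq i j; first by rewrite !dfwith_in.
by rewrite !dfwith_out// mulg1.
Qed.

Lemma factor_in1 i : factor_in (1%g : G i) = 1%g.
Proof.
apply: functional_extensionality_dep => j; rewrite /factor_in.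
by have [<-|ij] := eqVneq i j; rewrite ?dfwith_in// dfwith_out.
Qed.

(** Coordinates are peeled off one by one, along a list containing all those where [g] is
    nontrivial. *)
Lemma prodG_ind (P : prodG G -> Prop) : P 1%g ->
  (forall g h, P g -> P h -> P (g * h)%g) -> (forall i g, factor i g -> P g) ->
  forall g, P g.
Proof.
move=> P1 PM Pf g.
suff: forall (s : seq 'I_n) g, (forall i, i \notin s -> g i = 1%g) -> P g.
  by move/(_ (enum 'I_n) g); apply => i; rewrite mem_enum.
elim=> [|i s IH] {}g gs.
  by rewrite (_ : g = 1%g)//; apply: functional_extensionality_dep => i; exact: gs.
have [_ ->] := factor_decomp i g; apply: PM; first exact: Pf (factor_inP _).
apply: IH => j js; have [<-|ij] := eqVneq i j; first by rewrite dfwith_in.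
by rewrite dfwith_out// gs// inE negb_or eq_sym ij.
Qed.

End Factors.

Section Splitting.
Variables (R : realType) (n : nat) (G : 'I_n -> groupType) (X : metricType R).
Hypotheses (X_proper : proper_space X) (X_CAT0 : CAT0 X).
Variable a : prodG G -> X -> X.
Hypothesis a_isom : isometric_action a.
Hypothesis a_nonevanescent : nonevanescent a.
Local Notation d := (@mdist R X).
Implicit Types (i j : 'I_n) (x y z w : X) (g : prodG G).

Let SV i := @factorV n G i.
Let SC i := @factor_comm n G i.
Let SS i g : exists s s', [/\ factor i s, cofactor i s' & g = (s * s')%g].
Proof.
have [h1 h2] := factor_decomp i g.
by exists (factor_in (g i)), (dfwith g (1%g : G i)); split=> //; exact: factor_inP.
Qed.

Let projf i := proj_complement X_proper X_CAT0 a_isom a_nonevanescent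
  (@SV i) (@SC i) (SS i).
Let affinef i := proj_affine X_proper X_CAT0 a_isom a_nonevanescent
  (@SV i) (@SC i) (SS i).
Let productf i := leaf_product X_proper X_CAT0 a_isom a_nonevanescent
  (@SV i) (@SC i) (SS i).
Let leaves_convexf i := leaves_convex X_proper X_CAT0 a_isom (@SV i).
Let leaves_closedf i := leaves_closed X_proper X_CAT0 a_isom (@SV i).

(** * Coordinates on a minimal set for the whole product *)

Section Coordinates.
Variables (Z : set X) (M : 'I_n -> set X).
Hypotheses (Zm : minimal a setT Z) (Mm : forall i, minimal a (factor i) (M i)).
Hypothesis MZ : forall i, M i `<=` Z.

Let coord i x := proj (M i) x.

Lemma minimal_actT g z : Z z -> Z (a g z).
Proof. by move=> Zz; apply: minimal_act Zm _ Zz. Qed.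

(** The leaves inside [Z] form a set stable under the whole group, nonempty because of [M i]. *)
Lemma sub_leaves i : Z `<=` leaves a (factor i).
Proof.
have [[[_ Zcl Zc] _] Zmin] := Zm.
have LS : stable a setT (Z `&` leaves a (factor i)).
  split; first split.
  - have [[[[x Mx] _ _] _] _] := Mm i.
    by exists x; split; [exact: MZ Mx|exists (M i)].
  - refine (closedI Zcl _).
    exact: leaves_closedf.
  - apply: convexI => //; exact: leaves_convexf.
  - move=> g x _ [Zx Lx]; split; first exact: minimal_actT.
    exact: (leaves_act X_proper X_CAT0 a_isom (@SC i) (SS i)).
by apply: subset_trans (Zmin _ LS (@subIsetl _ _ _)) (@subIsetr _ _ _).
Qed.

Lemma leaf_sub i N z : minimal a (factor i) N -> N z -> Z z -> N `<=` Z.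
Proof.
move=> [[[_ Ncl Nc] NS] Nmin] Nz Zz; have [[[_ Zcl Zc] _] _] := Zm.
have NZ : stable a (factor i) (N `&` Z).
  split; first split.
  - by exists z.
  - exact: (closedI Ncl Zcl).
  - exact: convexI.
  - by move=> g x Sg [Nx Zx]; split; [exact: NS|exact: minimal_actT].
by apply: subset_trans (Nmin _ NZ (@subIsetl _ _ _)) (@subIsetr _ _ _).
Qed.

Lemma coord_in i x : M i (coord i x).
Proof. exact: proj_in_minimal (Mm i). Qed.

Lemma coord_factor i g z : factor i g -> coord i (a g z) = a g (coord i z).
Proof. by move=> gi; apply: (proj_act X_proper X_CAT0 a_isom (@SV i)). Qed.

Lemma coord_cofactor i g z : cofactor i g -> Z z -> coord i (a g z) = coord i z.
Proof. by move=> gi /sub_leaves Lz; apply: projf (Mm i) (Lz i) gi. Qed.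

Lemma coord_affine i x y p (t : R) : Z x -> Z y -> 0 <= t <= 1 ->
  between t x y p -> between t (coord i x) (coord i y) (coord i p).
Proof.
by move=> /sub_leaves Lx /sub_leaves Ly; apply: affinef (Mm i) (Lx i) (Ly i).
Qed.

(** For [i != j] the factor [j] preserves the coordinate [i], whose level sets in [N] are convex
    because it is affine. *)
Lemma coord_leaf i j N x y : i != j -> minimal a (factor j) N -> N `<=` Z ->
  N x -> N y -> coord i y = coord i x.
Proof.
move=> ij Nm NZ Nx; move: y; have [[[_ Ncl Nc] NS] _] := Nm.
apply: (minimal_sub (P := [set y | coord i y = coord i x]) (x0 := x) Nm) => //.
- apply/metric_closedP => y yP.
  have Ny : N y.
    by apply: ((metric_closedP N).1 Ncl) => e /yP[z [Nz _] yz]; exists z.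
  split=> //; apply/mdist_positivity/eqP; rewrite eq_le mdist_ge0 andbT.
  apply/ler_addgt0Pl => e /yP[z [_ /= <-] /ltW yz]; rewrite addr0.
  apply: le_trans yz; apply: (proj_lipschitz X_proper X_CAT0).
  exact: minimal_closed_convex (Mm i).
- move=> y z p t [Ny /= yP] [Nz /= zP] t01 yzp.
  split; first exact: Nc yzp.
  have [h _] := coord_affine i (NZ _ Ny) (NZ _ Nz) t01 yzp.
  by apply/esym/mdist_positivity; rewrite -yP h yP zP mdistxx mulr0.
- move=> g y gj Ny /= <-; apply: coord_cofactor; last exact: NZ.
  by apply: gj; rewrite eq_sym.
Qed.

(** [tau] slides each point within its [j]-leaf to the position over [m]; the Pythagorean clause is
    [leaf_product] with base [m]. *)
Lemma move_coord j m : M j m -> exists tau : X -> X, forall z, Z z ->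
  [/\ Z (tau z), coord j (tau z) = m,
      forall i, i != j -> coord i (tau z) = coord i z &
      forall w, Z w -> d z w ^+ 2 = d (coord j z) (coord j w) ^+ 2
                                 + d (tau z) (tau w) ^+ 2].
Proof.
move=> Mm_; have Zmm : Z m by exact: MZ Mm_.
have /choice[N NP] z : exists N, Z z ->
    [/\ minimal a (factor j) N, N z & N `<=` Z].
  have [Zz|nZz] := pselect (Z z); last by exists set0.
  have [N Nm Nz] := sub_leaves j Zz; exists N => _; split=> //.
  exact: leaf_sub Nm Nz Zz.
exists (fun z => proj (N z) m) => z Zz; have [Nm Nz NZ] := NP z Zz.
have Nt : N z (proj (N z) m) by exact: proj_in_minimal Nm.
split.
- exact: NZ.
- exact: (proj_projK X_proper X_CAT0 a_isom (@SV j) (Mm j) Nm Mm_).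
- by move=> i ij; apply: coord_leaf ij Nm NZ Nz Nt.
- move=> w Zw; have [N'm N'w _] := NP w Zw.
  exact: productf (Mm j) Nm N'm (sub_leaves j Zmm) Nz N'w.
Qed.

(** Composing the moves strips the coordinates from the metric one at a time. *)
Lemma move_coords (m : 'I_n -> X) : (forall i, M i (m i)) ->
  exists tau : X -> X, forall z, Z z ->
  [/\ Z (tau z), forall i, coord i (tau z) = m i &
      forall w, Z w -> d z w ^+ 2 = \sum_i d (coord i z) (coord i w) ^+ 2
                                 + d (tau z) (tau w) ^+ 2].
Proof.
move=> Mi; have : uniq (index_enum 'I_n) by exact: index_enum_uniq.
suff: forall s : seq 'I_n, uniq s -> exists tau : X -> X, forall z, Z z ->
    [/\ Z (tau z), forall i, coord i (tau z) = if i \in s then m i else coord i z &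
      forall w, Z w -> d z w ^+ 2 = \sum_(i <- s) d (coord i z) (coord i w) ^+ 2
                                 + d (tau z) (tau w) ^+ 2].
  move=> h /h[tau tauP]; exists tau => z Zz; have [h1 h2 h3] := tauP z Zz.
  by split=> // i; rewrite h2 mem_index_enum.
elim=> [_|j s IH /= /andP[js /IH[tau tauP]]].
  by exists id => z Zz; split=> // w Zw; rewrite big_nil add0r.
have [tau' tau'P] := move_coord (Mi j).
exists (tau' \o tau) => z Zz /=; have [h1 h2 h3] := tauP z Zz.
have [k1 k2 k3 k4] := tau'P _ h1; split=> //.
  move=> i; rewrite inE; have [->//|ij] := eqVneq i j.
  by rewrite k3// h2.
move=> w Zw; have [l1 l2 _] := tauP w Zw.
rewrite big_cons h3// k4// h2 l2 (negbTE js); ring.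
Qed.

(* The part of the metric not seen by the coordinates is a pseudo-metric whose
   zero classes are invariant under every factor, so minimality of [Z] kills it. *)
Lemma dist_coords z w : Z z -> Z w ->
  d z w ^+ 2 = \sum_i d (coord i z) (coord i w) ^+ 2.
Proof.
move=> Zz Zw; have [tau tauP] := move_coords (fun i => coord_in i w).
have tauE x y : Z x -> Z y ->
    d x y ^+ 2 = \sum_i d (coord i x) (coord i y) ^+ 2 + d (tau x) (tau y) ^+ 2.
  by move=> Zx Zy; have [_ _ ->] := tauP x Zx.
suff tauC : tau z = tau w by rewrite tauE// tauC mdistxx expr0n addr0.
(* For [g] in one factor, [x] and [a g x] share a leaf, where the corresponding coordinate is
   isometric and already accounts for their whole distance. *)
have tau_act g : forall x, Z x -> tau (a g x) = tau x.
  elim/prodG_ind: g => [x Zx|g h IHg IHh x Zx|i g gi x Zx].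
  - by rewrite (act1 a_isom).
  - by rewrite (actM a_isom) IHg ?IHh//; exact: minimal_actT.
  have [N Nm Nx] := sub_leaves i Zx; have NZ := leaf_sub Nm Nx Zx.
  have Ngx := minimal_act Nm gi Nx.
  have := tauE _ _ (NZ _ Ngx) Zx; rewrite (bigD1 i)//= big1 => [|j ji].
    rewrite /coord (proj_isometry X_proper X_CAT0 a_isom (@SV i) Nm (Mm i))//.
    rewrite addr0 -[LHS]addr0 => /addrI/esym/eqP; rewrite sqrf_eq0 => /eqP.
    exact: mdist_positivity.
  by rewrite (coord_leaf ji Nm NZ Nx Ngx) mdistxx expr0n.
have [[[_ Zcl Zc] _] _] := Zm.
move: z Zz; apply: (minimal_sub (P := [set z | tau z = tau w]) (x0 := w) Zm) => //.
- apply/metric_closedP => x xP.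
  have Zx : Z x.
    by apply: ((metric_closedP Z).1 Zcl) => e /xP[y [Zy _] xy]; exists y.
  split=> //; apply/mdist_positivity/eqP; rewrite eq_le mdist_ge0 andbT.
  apply/ler_addgt0Pl => e /xP[y [Zy /= <-] /ltW xy]; rewrite addr0.
  apply: le_trans xy; apply: ler_dist2; rewrite (tauE x y)// lerDr.
  by apply: sumr_ge0 => i _; exact: sqr_ge0.
- move=> x y p t [Zx /= xP] [Zy /= yP] t01 xyp.
  have Zp := Zc _ _ _ _ Zx Zy t01 xyp; split=> //=; rewrite -xP.
  apply/esym/mdist_positivity/eqP; rewrite -sqrf_eq0; apply/eqP.
  have E1 := tauE x p Zx Zp; have E2 := tauE x y Zx Zy.
  rewrite xP yP mdistxx expr0n addr0 in E2.
  (* Coordinates and distance scale by the same [t] along a segment, which leaves nothing for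
     [tau]. *)
  have E3 : \sum_i d (coord i x) (coord i p) ^+ 2 = t ^+ 2 * d x y ^+ 2.
    rewrite E2 mulr_sumr; apply: eq_bigr => i _.
    by have [-> _] := coord_affine i Zx Zy t01 xyp; rewrite exprMn.
  have [xp _] := xyp; rewrite E3 xp exprMn xP in E1.
  by rewrite xP; lra.
- by move=> g x _ Zx /= <-; exact: tau_act.
Qed.

Definition factor_act i (g : G i) (x : induced (M i)) : induced (M i) :=
  exist _ (a (factor_in g) (sval x))
    (mem_set (minimal_act (Mm i) (factor_inP g) (set_mem (svalP x)))).

Lemma factor_act_isometric i : isometric_action (@factor_act i).
Proof.
split=> [x|g h x|g x y].
- by apply/val_inj; rewrite /= factor_in1 (act1 a_isom).
- by apply/val_inj; rewrite /= factor_inM (actM a_isom).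
- exact: (act_dist a_isom).
Qed.

(** [f] picks the point of [Z] with prescribed coordinates: [move_coords] gives existence,
    [dist_coords] uniqueness and isometry. *)
Lemma minimal_splits : splits_equivariantly a Z.
Proof.
exists (fun i => induced (M i)), factor_act; split; first exact: factor_act_isometric.
have [[[[z0 Zz0] _ _] _] _] := Zm.
have inj z w : Z z -> Z w -> (forall i, coord i z = coord i w) -> z = w.
  move=> Zz Zw e; apply/mdist_positivity/eqP; rewrite -sqrf_eq0 dist_coords//.
  by rewrite big1// => i _; rewrite e mdistxx expr0n.
have /choice[f fP] (m : l2prod (fun i => induced (M i))) :
    exists z, Z z /\ forall i, coord i z = sval (m i).
  have [|tau /(_ _ Zz0)[h1 h2 _]] := @move_coords (fun i => sval (m i)).
    by move=> i; exact: set_mem (svalP (m i)).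
  by exists (tau z0).
exists f; split.
- move=> m m'; have [Zm1 m1] := fP m; have [Zm2 m2] := fP m'.
  apply/eqP; rewrite -(@eqrXn2 _ 2)// ?mdist_ge0//; apply/eqP.
  rewrite dist_coords// -[mdist m m']/(l2norm _) l2norm_sqr.
  by apply: eq_bigr => i _; rewrite m1 m2.
- apply/seteqP; split=> [_ [m _ <-]|z Zz]; first by case: (fP m).
  pose m : l2prod (fun i => induced (M i)) :=
    fun i => exist _ (coord i z) (mem_set (coord_in i z)).
  by exists m => //; have [h1 h2] := fP m; apply: inj.
- move=> g m; have [h1 h2] := fP m; have [k1 k2] := fP (prod_action factor_act g m).
  apply: inj => //; first exact: minimal_actT.
  move=> i; rewrite k2 /=; have [hi {2}->] := factor_decomp i g.
  rewrite (actM a_isom) coord_factor; last exact: factor_inP.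
  by rewrite coord_cofactor// h2.
Qed.

End Coordinates.

Lemma exists_minimal_split : [set: X] !=set0 ->
  exists Z : set X, [/\ Z !=set0, closed Z, convex Z, action_invariant a Z &
    splits_equivariantly a Z].
Proof.
move=> [x0 _].
(* Minimality for the whole group is the case of [setT] with [[set 1%g]] as commuting set. *)
have TC (g h : prodG G) : setT g -> [set 1%g] h -> (g * h = h * g)%g.
  by move=> _ ->; rewrite mulg1 mul1g.
have TS (g : prodG G) : exists s s', [/\ setT s, [set 1%g] s' & g = (s * s')%g].
  by exists g, 1%g; rewrite mulg1.
have XT : stable a setT setT by split=> //; split=> //; exists x0.
have [Z Zm _] := minimal_exists X_proper X_CAT0 a_isom a_nonevanescent
  (fun g _ => I) TC TS XT (I : setT x0).
have [[[[z Zz] Zcl Zc] ZS] _] := Zm.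
have /choice[M MP] i : exists M, minimal a (factor i) M /\ M `<=` Z.
  have Zi : stable a (factor i) Z by split=> [|g x _]; [case: Zm => [[]]|exact: ZS].
  have [M] := minimal_exists X_proper X_CAT0 a_isom a_nonevanescent
    (@SV i) (@SC i) (SS i) Zi Zz.
  by exists M.
exists Z; split=> //; first by exists z.
  by move=> g x; exact: ZS.
by apply: (@minimal_splits Z M) => // i; case: (MP i).
Qed.

End Splitting.

Theorem corollary10 (R : realType) (n : nat) (n_gt0 : (0 < n)%N)
    (G : 'I_n -> groupType) (X : metricType R) (X_nonempty : [set: X] !=set0)
    (X_proper : proper_space X) (X_CAT0 : CAT0 X)
    (a : prodG G -> X -> X) (a_isom : isometric_action a) :
  fixed_boundary_point a \/
  exists Z : set X,
    [/\ Z !=set0, closed Z, geodesically_convex Z, action_invariant a Z &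
        splits_equivariantly a Z].
Proof.
have [fixed|nofix] := pselect (fixed_boundary_point a); [by left|right].
have nonev := no_fixed_boundary_point_nonevanescent X_proper X_CAT0 a_isom nofix.
have [Z [Zn Zcl Zc ZS Zsplit]] :=
  exists_minimal_split X_proper X_CAT0 a_isom nonev X_nonempty.
by exists Z; split=> //; exact: convex_geodesically_convex.
Qed.
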